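(* For real $\alpha,\beta,\gamma>0$, let $$E_{\alpha,\beta}^{\gamma}(z)=\sum_{n=0}^\infty\frac{\Gamma(\gamma+n)}{\Gamma(\gamma)\,n!\,\Gamma(\beta+\alpha n)}\,z^n$$ be the (entire) Prabhakar function. Then $x\mapsto E_{\alpha,\beta}^{\gamma}(-x)$ is completely monotone on $(0,\infty)$ if and only if $0<\alpha\leq 1$ and $\beta\geq\alpha\gamma$.
   Context: A smooth function $f:(0,\infty)\to\mathbb{R}$ is completely monotone on $(0,\infty)$ if $(-1)^n f^{(n)}(x)\geq 0$ for every integer $n\geq 0$ and every $x>0$. *)

(* Defs.v *)
From mathcomp Require Import all_boot all_order all_algebra.
From mathcomp Require Import all_classical all_reals all_analysis.

Set Implicit Arguments.
Unset Strict Implicit.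
Unset Printing Implicit Defensive.

Import Order.TTheory GRing.Theory Num.Theory.
Import numFieldNormedType.Exports.

Local Open Scope classical_set_scope.
Local Open Scope ring_scope.

(* Euler's integral; it is only used at positive arguments, where it
   converges. *)
Definition Gamma (R : realType) (s : R) : R :=
  \int[@lebesgue_measure R]_(t in `]0, +oo[) (t `^ (s - 1) * expR (- t)).

Definition prabhakar_coeff (R : realType) (alpha beta gamma : R) (n : nat) : R :=
  Gamma (gamma + n%:R) /
    (Gamma gamma * n`!%:R * Gamma (beta + alpha * n%:R)).

(* limn has an arbitrary value on divergent sequences, but the radius of
   convergence is infinite when alpha, beta, gamma > 0. *)
Definition prabhakar (R : realType) (alpha beta gamma z : R) : R :=
  limn (pseries (prabhakar_coeff alpha beta gamma) z).

(* Derivatives are iterated on all of R; at x > 0 they only depend on the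
   restriction of f to a neighbourhood of x, hence on f on (0, +oo). *)
Definition smooth_on_pos (R : realType) (f : R -> R) : Prop :=
  forall (n : nat) (x : R), 0 < x -> derivable (derive1n n f) x 1.

Definition completely_monotone (R : realType) (f : R -> R) : Prop :=
  smooth_on_pos f /\
  forall (n : nat) (x : R), 0 < x -> 0 <= (-1) ^+ n * derive1n n f x.

(* Main.v *)
Require Import Defs.
From mathcomp Require Import all_boot all_order all_algebra.
From mathcomp Require Import all_classical all_reals all_analysis.
From mathcomp Require Import measurable_realfun ring lra.

(** Write [negbin a n] for the coefficient of z^n in (1-z)^(-a).  Since
    Gamma(a+n) = n! (negbin a n) Gamma(a), the function is
    E(z) = sum_k (negbin gamma k) z^k / Gamma(beta + alpha k).

    Its derivative is gamma times the same function with parameters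
    beta + alpha and gamma + 1.  So E(-x) is completely monotone exactly when
    all the functions with parameters (beta + alpha k, gamma + k) are
    nonnegative at -x for x > 0, and beta >= alpha gamma is stable under this
    shift of parameters.

    _Positivity when alpha <= 1 and beta >= alpha gamma._  The Laplace
    transform of t^(beta-1) E(-l t^alpha) is
    s^(alpha gamma - beta) (s^alpha + l)^(-gamma).  The proof replaces s by
    1 - z: for 0 < l < 1, [rcoef alpha l gamma beta n] is the coefficient of
    z^n in (1-z)^(alpha gamma - beta) ((1-z)^alpha + l)^(-gamma).
    If beta = alpha gamma, the derivative of this series is alpha gamma times
    (1-z)^(-(1-alpha)) times the series for gamma + 1; as the middle factor has
    nonnegative coefficients, induction on n, for all gamma at once, reduces
    the sign of the coefficients to that of the constant terms
    (1+l)^(-gamma) > 0.  The remaining factor (1-z)^(-(beta - alpha gamma)) has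
    nonnegative coefficients too ([rcoef_ge0]).
    With l = x (beta+n)^(-alpha), the n-th coefficient multiplied by
    n! / Gamma(beta+n) tends to E(-x), which is therefore nonnegative
    ([prabhakar_ge0]).  The limit is taken term by term: the ratios
    Gamma(s+b) / (Gamma(s) s^b) tend to 1 by Wendel's inequality
    ([Gamma_wendel]), and they are nonincreasing along s, s+1, s+2, ... when
    b >= 1, which provides a dominating series.

    _Necessity of alpha <= 1._  If f is completely monotone and
    F_k = (-1)^k f^(k), comparing Taylor expansions at 0 and at N gives
    N F_1(0) <= K F_0(0) + F_(K+1)(0) N^(K+1) / K!
    ([cm_first_derivative_bound]).  If alpha > 1, the Taylor coefficients of E
    decay so fast that the choice N = A n, K = n - 1 with n large makes the
    last term at most n C with C independent of A, hence
    A F_1(0) <= F_0(0) + C for every A, which is absurd since F_1(0) > 0.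

    _Necessity of beta >= alpha gamma, given alpha <= 1._  Integrating
    E(-l u^alpha) against u^(beta+n-1) e^(-u) shows that E >= 0 on the negative
    axis forces all [rcoef alpha l gamma beta n] to be nonnegative.  Suppose
    d = alpha gamma - beta > 0.  Then the series
    ((1-z)^alpha + l)^(-gamma), which is (1-z)^(-d) times the previous one, has
    partial coefficient sums at least as large as [negbin (d + 1) N] up to a
    positive factor, and these are unbounded.  But its coefficients are,
    up to a constant factor, at most those of ((1-z)^alpha + l)^(-m) for an
    integer m >= gamma, whose sums are at most l^(-m) ([rcoef_not_ge0]). *)

Set Implicit Arguments.
Unset Strict Implicit.
Unset Printing Implicit Defensive.

Import Order.TTheory GRing.Theory Num.Theory.
Import numFieldNormedType.Exports.

Local Open Scope classical_set_scope.
Local Open Scope ring_scope.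

(** * The Gamma function *)

Section GammaFunction.
Variable R : realType.
Implicit Types (s t a x : R).
Local Notation mu := (@lebesgue_measure R).
Local Notation Rpos := (`]0, +oo[%classic : set R).

Definition gamma_kernel s t : R := t `^ (s - 1) * expR (- t).

Lemma gamma_kernel_ge0 s t : 0 <= gamma_kernel s t.
Proof. by rewrite mulr_ge0 ?powR_ge0 ?expR_ge0. Qed.

Lemma measurable_gamma_kernel s (D : set R) :
  measurable_fun D (gamma_kernel s).
Proof.
apply: measurable_funTS; apply: measurable_funM.
  exact: measurable_powR.
exact: (measurableT_comp (@measurable_expR R)).
Qed.

Definition eGamma s : \bar R := (\int[mu]_(t in Rpos) (gamma_kernel s t)%:E)%E.

Lemma GammaE s : Gamma s = fine (eGamma s).
Proof. by []. Qed.

Lemma eGamma_ge0 s : (0 <= eGamma s)%E.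
Proof. by apply: integral_ge0 => t _; rewrite lee_fin gamma_kernel_ge0. Qed.

(** Comparison of the exponential with a single term of its series. *)
Lemma powR_expRN_le s (m : nat) t : s <= m%:R -> 1 <= t ->
  t `^ s * expR (- t) <= m.+1`!%:R / t.
Proof.
move=> sm t1; have t0 : 0 < t by exact: lt_le_trans t1.
have e1 : t ^+ m.+1 / m.+1`!%:R <= expR t.
  by apply: le_trans (expR_ge1Dxn m (ltW t0)); rewrite lerDr.
rewrite expRN ler_pdivrMr ?expR_gt0//.
rewrite mulrAC ler_pdivlMr//.
apply: le_trans (_ : t ^+ m * t <= _).
  by rewrite ler_pM2r// -(powR_mulrn _ (ltW t0)); exact: ler_powR.
rewrite -exprSr mulrC -ler_pdivrMr ?ltr0n ?fact_gt0//.
Qed.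

Lemma gamma_kernel_cvg_infty s :
  (n.+1%:R `^ s * expR (- n.+1%:R)) @[n --> \oo] --> (0 : R).
Proof.
have [m sm] : exists m : nat, s <= m%:R.
  by exists (Num.truncn `|s|).+1; rewrite (le_trans (ler_norm _))// ltW// truncnS_gt.
apply: (@squeeze_cvgr _ _ _ _ (cst 0) (fun n => m.+1`!%:R * @harmonic R n)).
- apply: nearW => n; rewrite mulr_ge0 ?powR_ge0 ?expR_ge0//=.
  by apply: powR_expRN_le => //; rewrite ler1n.
- exact: cvg_cst.
- by rewrite -[X in _ --> X](mulr0 (m.+1`!%:R)); apply: cvgMr; exact: cvg_harmonic.
Qed.

Lemma gamma_kernel_cvg_0 s : 0 < s ->
  ((@harmonic R n) `^ s * expR (- (@harmonic R n))) @[n --> \oo] --> (0 : R).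
Proof.
move=> s0.
apply: (@squeeze_cvgr _ _ _ _ (cst 0) (fun n => (@harmonic R n) `^ s)).
- apply: nearW => n; rewrite mulr_ge0 ?powR_ge0 ?expR_ge0//=.
  by rewrite ler_piMr ?powR_ge0// expR_le1 oppr_le0 invr_ge0 ler0n.
- exact: cvg_cst.
- have /cvg_at_rightP H := powR_cvg0 s0.
  by apply: H; split => [n|]; [exact: harmonic_gt0|exact: cvg_harmonic].
Qed.

(** Compact intervals exhausting the half line: the integrand is singular at 0
    when s < 1, so integration by parts is done on these and passed to the
    limit. *)
Let window (n : nat) : set R := `[(@harmonic R n), n.+1%:R]%classic.

Lemma bigcup_window : \bigcup_n window n = Rpos.
Proof.
apply/seteqP; split => [t [n _]|t]; rewrite /window/= !in_itv/= ?andbT.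
  by move=> /andP[h _]; apply: lt_le_trans h; exact: harmonic_gt0.
move=> t0.
have [n nt] : exists n : nat, t <= n%:R /\ t^-1 <= n%:R.
  exists (Num.truncn (t + t^-1)).+1; have := truncnS_gt (t + t^-1).
  have : 0 < t^-1 by rewrite invr_gt0.
  by move=> *; split; apply/ltW; lra.
exists n => //; rewrite /window/= in_itv/=; apply/andP; split.
  rewrite -[leRHS]invrK lef_pV2 ?posrE ?invr_gt0 ?ltr0n//.
  by apply: (le_trans nt.2); rewrite ler_nat.
by apply: (le_trans nt.1); rewrite ler_nat.
Qed.

Lemma nondecreasing_window : nondecreasing_seq window.
Proof.
move=> m n mn; apply/subsetPset => t; rewrite /window/= !in_itv/= => /andP[h1 h2].
apply/andP; split; last by apply: le_trans h2 _; rewrite ler_nat.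
apply: le_trans h1; rewrite lef_pV2 ?posrE ?ltr0n// ler_nat//.
Qed.

Lemma eGamma_cvg s :
  (\int[mu]_(t in window n) (gamma_kernel s t)%:E)%E @[n --> \oo] --> eGamma s.
Proof.
rewrite /eGamma -bigcup_window.
apply: ge0_nondecreasing_set_cvg_integral.
- exact: nondecreasing_window.
- by move=> n; exact: measurable_itv.
- by move=> n; apply/measurable_EFinP; exact: measurable_gamma_kernel.
- by move=> n t _; rewrite lee_fin gamma_kernel_ge0.
Qed.

Lemma gamma_kernel_parts s n : 0 < s ->
  (\int[mu]_(t in window n) (gamma_kernel (s + 1) t)%:E =
   (@harmonic R n `^ s * expR (- @harmonic R n)
     - n.+1%:R `^ s * expR (- n.+1%:R))%:E
   + s%:E * \int[mu]_(t in window n) (gamma_kernel s t)%:E)%E.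
Proof.
move=> s0.
have [->|n0] := eqVneq n 0%N.
  have J0 : window 0 = [set 1].
    rewrite /window /harmonic/= invr1; apply/seteqP.
    split => t /=; rewrite in_itv/=; last by move=> ->; rewrite lexx.
    by move=> /andP[? ?]; apply/eqP; rewrite eq_le; apply/andP.
  by rewrite J0 !integral_set1 /harmonic/= invr1 subrr mule0 adde0.
have ab : @harmonic R n < n.+1%:R.
  rewrite /harmonic/= invf_plt ?posrE ?ltr0n// (@lt_trans _ _ 1)//.
    by rewrite invf_lt1 ?ltr0n// ltr1n ltnS lt0n.
  by rewrite ltr1n ltnS lt0n.
have pos (t : R) : @harmonic R n <= t -> 0 < t.
  by apply: lt_le_trans; exact: harmonic_gt0.
have cpow (r t : R) : 0 < t -> {for t, continuous (fun t : R => t `^ r)}.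
  move=> t0; apply: differentiable_continuous; apply/derivable1_diffP.
  by apply: derivable_powR; rewrite in_itv/= t0.
have cexp (t : R) : {for t, continuous (fun t : R => expR (- t))}.
  by apply: continuous_comp; [exact: opp_continuous|exact: continuous_expR].
have w (f : R -> R) : (forall t, 0 < t -> {for t, continuous f}) ->
    {within window n, continuous f}.
  move=> cf; apply: continuous_in_subspaceT => t; rewrite inE /window/= in_itv/=.
  by move=> /andP[/pos ? _]; exact: cf.
have := @integration_by_parts R (fun t => t `^ s) (fun t => - expR (- t))
  (fun t => s * t `^ (s - 1)) (fun t => expR (- t)) _ _ ab.
move=> IP.
under eq_integral do rewrite /gamma_kernel addrK.
rewrite IP; first last.
- move=> t _; rewrite derive1N; last first.
    by apply: ex_derive.
  rewrite derive1_comp//; rewrite derive1N// derive1_id mulrN1 opprK derive1E.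
  by have /funeqP -> := @derive_expR R.
- split.
  + by move=> t _; exact: ex_derive.
  + by apply: cvg_at_right_filter; apply: cvgN; exact: cexp.
  + by apply: cvg_at_left_filter; apply: cvgN; exact: cexp.
- by apply: w => t _; exact: cexp.
- move=> t; rewrite in_itv/= => /andP[/ltW/pos t0 _].
  by rewrite powR_derive1// in_itv/= t0.
- split.
  + move=> t; rewrite in_itv/= => /andP[/ltW/pos t0 _].
    by apply: derivable_powR; rewrite in_itv/= t0.
  + by apply: cvg_at_right_filter; apply: cpow; exact: harmonic_gt0.
  + by apply: cvg_at_left_filter; apply: cpow.
- by apply: w => t t0; apply: continuousM; [exact: cst_continuous|exact: cpow].
rewrite -ge0_integralZl_EFin; [| exact: measurable_itv
  | by move=> t _; rewrite lee_fin gamma_kernel_ge0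
  | by apply/measurable_EFinP; exact: measurable_gamma_kernel | exact: ltW].
rewrite -[X in (_ = _ + X)%E]oppeK -integral_ge0N; last first.
  by move=> t _; rewrite -EFinM lee_fin mulr_ge0 ?gamma_kernel_ge0 ?ltW.
congr (_ - _)%E; first by congr EFin; ring.
by apply: eq_integral => t _; rewrite /gamma_kernel -EFinM -EFinN; congr EFin; ring.
Qed.

(** The boundary terms of the integration by parts vanish in the limit. Working
    in the extended reals yields the functional equation before finiteness is
    known. *)
Lemma eGammaD1 s : 0 < s -> (eGamma (s + 1) = s%:E * eGamma s)%E.
Proof.
move=> s0.
have h1 := @eGamma_cvg (s + 1).
have h2 : (\int[mu]_(t in window n) (gamma_kernel (s + 1) t)%:E)%E @[n --> \oo] -->
    ((0 - 0)%:E + s%:E * eGamma s)%E.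
  under eq_cvg do rewrite gamma_kernel_parts//.
  apply: cvgeD; first by rewrite fin_num_adde_defr.
    apply: cvg_EFin; first exact: nearW.
    by apply: cvgB; [exact: gamma_kernel_cvg_0|exact: gamma_kernel_cvg_infty].
  by apply: cvgeZl => //; exact: eGamma_cvg.
by rewrite (cvg_unique _ h1 h2)// subrr add0e.
Qed.

Lemma eGamma1 : eGamma 1 = 1%E.
Proof.
rewrite /eGamma integral_itv_obnd_cbnd; last first.
  by apply/measurable_EFinP; exact: measurable_gamma_kernel.
rewrite -(@integral_exponential_pdf R 1)// [RHS](_ : _ =
  \int[mu]_(t in `[0%R, +oo[) (exponential_pdf 1 t)%:E)%E.
  apply: eq_integral => t; rewrite inE/= in_itv/= andbT => t0.
  by rewrite exponential_pdfE// /gamma_kernel subrr powRr0 mul1r mulN1r mul1r.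
rewrite [RHS]integral_mkcond; apply: eq_integral => t _.
rewrite patchE; case: ifPn => //; rewrite notin_setE/= in_itv/= andbT => /negP.
by rewrite -ltNge => t0; rewrite lt0_exponential_pdf.
Qed.

(** At positive integers finiteness follows from the functional equation; at
    r >= 1 from t^(r-1) <= 1 + t^m for an integer m >= r-1; and below 1 from
    the functional equation again. *)
Lemma eGamma_fin s : 0 < s -> eGamma s \is a fin_num.
Proof.
have nat_fin n : eGamma n.+1%:R \is a fin_num.
  elim: n => [|n IH]; first by rewrite eGamma1.
  by rewrite -[n.+2]addn1 natrD eGammaD1// fin_numM.
have ge1_fin r : 1 <= r -> eGamma r \is a fin_num.
  move=> r1.
  have [m rm] : exists m : nat, r <= m.+1%:R.
    by exists (Num.truncn r); rewrite ltW// truncnS_gt.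
  rewrite ge0_fin_numE ?eGamma_ge0//.
  apply: (@le_lt_trans _ _ (eGamma 1 + eGamma m.+1%:R)%E); last first.
    by rewrite ltey_eq fin_numD eGamma1 nat_fin.
  rewrite -ge0_integralD//; last 4 first.
  - by move=> t _; rewrite lee_fin gamma_kernel_ge0.
  - by apply/measurable_EFinP; exact: measurable_gamma_kernel.
  - by move=> t _; rewrite lee_fin gamma_kernel_ge0.
  - by apply/measurable_EFinP; exact: measurable_gamma_kernel.
  apply: ge0_le_integral => //.
  - by move=> t _; rewrite lee_fin gamma_kernel_ge0.
  - by apply/measurable_EFinP; exact: measurable_gamma_kernel.
  - by apply/measurable_EFinP; apply: measurable_funD; exact: measurable_gamma_kernel.
  - move=> t; rewrite /= in_itv/= andbT => t0.
    rewrite -EFinD lee_fin -mulrDl ler_wpM2r ?expR_ge0// subrr powRr0.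
    have [t1|t1] := leP 1 t.
      have rm1 : r - 1 <= m.+1%:R - 1 by rewrite lerD2r.
      by apply: (le_trans (ler_powR t1 rm1)); rewrite lerDr.
    apply: (@le_trans _ _ 1); last by rewrite lerDl powR_ge0.
    have t01 : 0 < t <= 1 by rewrite t0 ltW.
    have r0 : 0 <= r - 1 by rewrite subr_ge0.
    by apply: (le_trans (ger_powR t01 r0)); rewrite powRr0.
move=> s0; have := ge1_fin (s + 1); rewrite eGammaD1// => /(_ _).
rewrite !ge0_fin_numE ?eGamma_ge0//; last by rewrite mule_ge0 ?eGamma_ge0// lee_fin ltW.
move=> h; have {}h := h (ltac:(lra)).
rewrite ltey; apply/eqP => e; move: h; rewrite e gt0_muley ?lte_fin//.
Qed.

Lemma EFin_Gamma s : 0 < s -> (Gamma s)%:E = eGamma s.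
Proof. by move=> s0; rewrite GammaE fineK// eGamma_fin. Qed.

Lemma GammaD1 s : 0 < s -> Gamma (s + 1) = s * Gamma s.
Proof.
move=> s0; have s10 : 0 < s + 1 by lra.
by apply: EFin_inj; rewrite EFinM !EFin_Gamma// eGammaD1.
Qed.

(** Keep only the part of the integral over [x, x+1]. As x is free, this gives
    growth faster than any exponential. *)
Lemma Gamma_ge_powR s x : 1 <= s -> 0 < x ->
  x `^ (s - 1) * expR (- (x + 1)) <= Gamma s.
Proof.
move=> s1 x0; have s0 : 0 < s by lra.
rewrite -lee_fin EFin_Gamma//.
pose S : set R := `[x, x + 1]%classic.
have sub : S `<=` Rpos.
  by move=> t; rewrite /S/=; rewrite !in_itv/= andbT => /andP[h _]; exact: lt_le_trans h.
apply: (@le_trans _ _ (\int[mu]_(t in S) (gamma_kernel s t)%:E)%E).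
  apply: (@le_trans _ _ (\int[mu]_(t in S)
      (cst (x `^ (s - 1) * expR (- (x + 1)))%:E) t)%E).
    rewrite integral_cst; last exact: measurable_itv.
    have mS : mu S = 1%E.
      rewrite /S lebesgue_measure_itv/= lte_fin ltrDl ltr01.
      by rewrite -EFinB [x + 1]addrC addrK.
    by rewrite [X in (_ <= _ * X)%E](_ : _ = 1%E) ?mule1//; exact: mS.
  apply: ge0_le_integral; first exact: measurable_itv.
  - by move=> t _; rewrite lee_fin mulr_ge0 ?powR_ge0 ?expR_ge0.
  - exact: measurable_cst.
  - by apply/measurable_EFinP; exact: measurable_gamma_kernel.
  move=> t; rewrite /S/= in_itv/= => /andP[xt tx].
  rewrite lee_fin ler_pM ?powR_ge0 ?expR_ge0//.
    by rewrite ge0_ler_powR ?subr_ge0 ?nnegrE// ?ltW// (lt_le_trans x0).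
  by rewrite ler_expR lerN2.
apply: ge0_subset_integral => //; first exact: measurable_itv.
- by apply/measurable_EFinP; exact: measurable_gamma_kernel.
- by move=> t _; rewrite lee_fin gamma_kernel_ge0.
Qed.

Lemma Gamma_gt0 s : 0 < s -> 0 < Gamma s.
Proof.
move=> s0; suff : 0 < s * Gamma s by rewrite pmulr_rgt0.
rewrite -GammaD1//; apply: lt_le_trans (Gamma_ge_powR (_ : 1 <= s + 1) ltr01).
  by rewrite mulr_gt0 ?powR_gt0 ?expR_gt0.
by rewrite lerDr ltW.
Qed.

(** Weighted arithmetic-geometric mean inequality for 1 and y: it is the convex
    combination of the bounds 1+u <= e^u at u = -ln r and u = ln y - ln r, where
    r is the arithmetic mean. *)
Lemma powR_le_tangent1 a y : 0 <= a <= 1 -> 0 < y -> y `^ a <= 1 - a + a * y.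
Proof.
move=> /andP[a0 a1] y0; set r := 1 - a + a * y.
have r0 : 0 < r.
  have [a00|an0] := eqVneq a 0; first by rewrite /r a00; lra.
  have : 0 < a * y by rewrite mulr_gt0// lt0r an0.
  by rewrite /r; lra.
have e1 := expR_ge1Dx (- ln r).
have e2 := expR_ge1Dx (ln y - ln r).
rewrite expRN lnK ?posrE// in e1.
rewrite expRB !lnK ?posrE// in e2.
have E : (1 - a) * r^-1 + a * (y / r) = 1 by rewrite /r; field; rewrite -/r gt_eqF.
have a1' : 0 <= 1 - a by lra.
have := lerD (ler_wpM2l a1' e1) (ler_wpM2l a0 e2).
rewrite E => H.
have : a * ln y <= ln r by lra.
by rewrite -ler_expR lnK ?posrE// /powR gt_eqF.
Qed.

Lemma powR_le_tangent a t x : 0 <= a <= 1 -> 0 < t -> 0 < x ->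
  t `^ a <= x `^ a * (1 - a + a * (t / x)).
Proof.
move=> a01 t0 x0.
have y0 : 0 < t / x by rewrite divr_gt0.
rewrite -{1}[t](divfK (lt0r_neq0 x0)) mulrC powRM ?(ltW x0) ?(ltW y0)//.
by rewrite ler_wpM2l ?powR_ge0// powR_le_tangent1.
Qed.

Lemma Gamma_le_lin r p q c d : 0 < r -> 0 < p -> 0 < q -> 0 <= c -> 0 <= d ->
  (forall t, 0 < t ->
    gamma_kernel r t <= c * gamma_kernel p t + d * gamma_kernel q t) ->
  Gamma r <= c * Gamma p + d * Gamma q.
Proof.
move=> r0 p0 q0 c0 d0 H.
have cfin (x y : R) : (x * y)%:E = (x%:E * y%:E)%E by [].
have e : (c * Gamma p + d * Gamma q)%:E = (c%:E * eGamma p + d%:E * eGamma q)%E.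
  by rewrite -(EFin_Gamma p0) -(EFin_Gamma q0).
rewrite -lee_fin e {e} (EFin_Gamma r0) /eGamma.
have mk e : measurable_fun Rpos (fun t => (gamma_kernel e t)%:E).
  by apply/measurable_EFinP; exact: measurable_gamma_kernel.
have k0 e t : Rpos t -> (0 <= (gamma_kernel e t)%:E)%E.
  by move=> _; rewrite lee_fin gamma_kernel_ge0.
have ck0 x e t : 0 <= x -> Rpos t -> (0 <= x%:E * (gamma_kernel e t)%:E)%E.
  by move=> x0 tp; apply: mule_ge0; [rewrite lee_fin|exact: k0].
have mck x e : measurable_fun Rpos (fun t => x%:E * (gamma_kernel e t)%:E)%E.
  by apply: measurable_funeM; exact: mk.
rewrite -ge0_integralZl_EFin; [|exact: measurable_itv|exact: k0|exact: mk|exact: c0].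
rewrite -ge0_integralZl_EFin; [|exact: measurable_itv|exact: k0|exact: mk|exact: d0].
rewrite -ge0_integralD; [|exact: measurable_itv|by move=> t; exact: ck0
  |exact: mck|by move=> t; exact: ck0|exact: mck].
apply: ge0_le_integral;
  [exact: measurable_itv|exact: k0|exact: mk|by apply: emeasurable_funD; exact: mck|].
move=> t; rewrite /= in_itv/= andbT => t0.
by rewrite -!cfin -EFinD lee_fin H.
Qed.

(** Wendel's inequality, by integrating the tangent bound
    t^a <= s^a (1 - a + a t/s), which is exact at the mean t = s of the Gamma
    distribution of parameter s. *)
Lemma Gamma_wendel s a : 0 < s -> 0 <= a <= 1 ->
  Gamma (s + a) <= s `^ a * Gamma s.
Proof.
move=> s0 a01; have /andP[a0 a1] := a01; have sa0 : 0 < s + a by lra.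
have s10 : 0 < s + 1 by lra.
have -> : s `^ a * Gamma s =
    s `^ a * (1 - a) * Gamma s + s `^ a * a / s * Gamma (s + 1).
  by rewrite GammaD1//; field; rewrite gt_eqF.
apply: Gamma_le_lin => //.
- by rewrite mulr_ge0 ?powR_ge0// subr_ge0.
- by rewrite !mulr_ge0 ?powR_ge0// invr_ge0 ltW.
move=> t t0; rewrite /gamma_kernel.
have -> : t `^ (s + a - 1) = t `^ (s - 1) * t `^ a.
  by rewrite -powRD ?(gt_eqF t0) ?implybT//; congr (_ `^ _); ring.
have -> : t `^ (s + 1 - 1) = t `^ (s - 1) * t.
  by rewrite -{3}(powRr1 (ltW t0)) -powRD ?(gt_eqF t0) ?implybT//; congr (_ `^ _); ring.
set A := s `^ a; set B := t `^ (s - 1); set E := expR (- t).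
have -> : A * (1 - a) * (B * E) + A * a / s * (B * t * E) =
    B * E * (A * (1 - a + a * (t / s))) by ring.
rewrite mulrAC ler_wpM2l ?mulr_ge0 ?powR_ge0 ?expR_ge0//.
exact: powR_le_tangent.
Qed.

(** The upper bound applied at s+a with exponent 1-a, read backwards. *)
Lemma Gamma_wendel_ge s a : 0 < s -> 0 <= a <= 1 ->
  s / (s + a) * (s `^ a * Gamma s) <= Gamma (s + a).
Proof.
move=> s0 /andP[a0 a1]; have sa0 : 0 < s + a by lra.
have a01 : 0 <= 1 - a <= 1 by apply/andP; split; lra.
have := Gamma_wendel sa0 a01.
rewrite (_ : s + a + (1 - a) = s + 1) ?GammaD1//; last by ring.
have P0 : 0 < (s + a) `^ (1 - a) by rewrite powR_gt0.
rewrite -ler_pdivrMl// => /(le_trans _); apply.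
have G0 := Gamma_gt0 s0.
rewrite (_ : _ * (s * Gamma s) = (((s + a) `^ (1 - a))^-1 * s) * Gamma s); last by ring.
rewrite mulrA ler_pM2r//.
rewrite -powRN opprB.
rewrite powRB; last by rewrite (gt_eqF sa0) implybT.
rewrite powRr1 ?(ltW sa0)//.
rewrite [leRHS]mulrC mulrA -mulrA [_^-1 * _]mulrC mulrA ler_pM2r ?invr_gt0//.
rewrite ler_pM2l// ge0_ler_powR ?nnegrE// ?(ltW s0) ?(ltW sa0)// lerDl//.
Qed.

End GammaFunction.

(** * Coefficients of (1-z)^(-a) *)

Section NegBin.
Variable R : realType.
Implicit Types a b x : R.

Definition negbin a (n : nat) : R := \prod_(j < n) ((a + j%:R) / j.+1%:R).

Lemma negbin0 a : negbin a 0 = 1.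
Proof. by rewrite /negbin big_ord0. Qed.

Lemma negbinS a n : negbin a n.+1 = negbin a n * ((a + n%:R) / n.+1%:R).
Proof. by rewrite /negbin big_ord_recr. Qed.

Lemma negbin_ge0 a n : 0 <= a -> 0 <= negbin a n.
Proof. by move=> a0; apply: prodr_ge0 => j _; rewrite divr_ge0// addr_ge0. Qed.

Lemma negbin_gt0 a n : 0 < a -> 0 < negbin a n.
Proof. by move=> a0; apply: prodr_gt0 => j _; rewrite divr_gt0 ?ltr0Sn// ltr_wpDr. Qed.

(** Derivative of (1-z)^(-a), coefficientwise. *)
Lemma negbin_derive a n : n.+1%:R * negbin a n.+1 = a * negbin (a + 1) n.
Proof.
elim: n => [|n IH]; first by rewrite negbinS !negbin0; field.
rewrite negbinS (negbinS (a + 1)) [RHS]mulrA -IH -[n.+2%:R]natr1 -[n.+1%:R]natr1.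
by field; rewrite !natr1 !pnatr_eq0.
Qed.

Lemma negbin_shift a n : (a + n%:R) * negbin a n = a * negbin (a + 1) n.
Proof. by rewrite -negbin_derive negbinS -natr1; field; rewrite natr1 pnatr_eq0. Qed.

Lemma negbin_pascal a n : negbin (a + 1) n.+1 = negbin (a + 1) n + negbin a n.+1.
Proof.
apply: (@mulfI _ n.+1%:R); first by rewrite pnatr_eq0.
rewrite mulrDr [X in _ = _ + X]negbin_derive negbinS -natr1.
by field; rewrite natr1 pnatr_eq0.
Qed.

Lemma negbin1 n : negbin 1 n = 1.
Proof.
elim: n => [|n IH]; first exact: negbin0.
by rewrite negbinS IH mul1r [1 + _]addrC natr1 divff// pnatr_eq0.
Qed.

Lemma negbin_0S n : negbin 0 n.+1 = 0.
Proof. by rewrite /negbin big_ord_recl/= addr0 mul0r mul0r. Qed.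

(** Coefficients of the product (1-z)^(-a) (1-z)^(-b). Multiplying by n+1 means
    differentiating the product, which reduces n+1 to n by Leibniz' rule. *)
Lemma negbin_vandermonde a b n :
  negbin (a + b) n = \sum_(i < n.+1) negbin a i * negbin b (n - i)%N.
Proof.
elim: n a b => [|n IH] a b; first by rewrite big_ord_recr big_ord0 /= subnn !negbin0 add0r mulr1.
apply: (@mulfI _ n.+1%:R); first by rewrite pnatr_eq0.
rewrite negbin_derive.
have -> : n.+1%:R * (\sum_(i < n.+2) negbin a i * negbin b (n.+1 - i)%N) =
    \sum_(i < n.+2) (i%:R * negbin a i) * negbin b (n.+1 - i)%N +
    \sum_(i < n.+2) negbin a i * ((n.+1 - i)%:R * negbin b (n.+1 - i)%N).
  rewrite -big_split mulr_sumr/=; apply: eq_bigr => i _.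
  have -> : n.+1%:R = i%:R + (n.+1 - i)%:R :> R.
    by rewrite -natrD subnKC// -ltnS.
  by ring.
rewrite big_ord_recl/= mul0r mul0r add0r.
rewrite [X in _ = _ + X]big_ord_recr/= subnn mul0r mulr0 addr0.
under eq_bigr do rewrite /bump/= add1n negbin_derive subSS -mulrA.
under [X in _ = _ + X]eq_bigr => i _.
  rewrite subSn; last by rewrite -ltnS.
  rewrite negbin_derive mulrCA; over.
rewrite -!mulr_sumr -!IH.
have -> : a + 1 + b = a + b + 1 by ring.
have -> : a + (b + 1) = a + b + 1 by ring.
by rewrite mulrDl.
Qed.

Lemma ler_negbin a b n : 0 <= a -> a <= b -> negbin a n <= negbin b n.
Proof.
move=> a0 ab; apply: ler_prod => j _; rewrite divr_ge0 ?addr_ge0//=.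
by rewrite ler_pM2r ?invr_gt0 ?ltr0Sn// lerD2r.
Qed.

Lemma negbin_nat_le m n : negbin m%:R n <= n.+1%:R ^+ m.
Proof.
case: m => [|m].
  by case: n => [|n]; [rewrite negbin0 expr0|rewrite negbin_0S expr0].
elim: m => [|m IH]; first by rewrite negbin1 expr1 ler1n.
have m0 : 0 < m.+1%:R :> R by rewrite ltr0Sn.
rewrite -[m.+2%:R]natr1 -(ler_pM2l m0) -negbin_shift exprS mulrA.
apply: ler_pM => //; rewrite ?addr_ge0 ?negbin_ge0 ?ler0n//.
rewrite -natrD -natrM ler_nat mulnS leq_add2l.
by rewrite leq_pmull.
Qed.

Lemma negbin_le_poly a m n : 0 <= a <= m%:R -> negbin a n <= n.+1%:R ^+ m.
Proof. by move=> /andP[a0 am]; exact: le_trans (ler_negbin _ a0 am) (negbin_nat_le _ _). Qed.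

Lemma normr_negbin_le a n : `|negbin a n| <= (1 + `|a|) ^+ n.
Proof.
rewrite /negbin normr_prod -[X in _ <= _ ^+ X]card_ord -prodr_const.
apply: ler_prod => j _; rewrite normr_ge0/= normrM normfV.
rewrite [X in _ / X]ger0_norm// ler_pdivrMr ?ltr0Sn//.
apply: (le_trans (ler_normD _ _)); rewrite [X in _ + X]ger0_norm//.
have := normr_ge0 a; rewrite -natr1 => ?.
have := ler0n R j => ?; have : 0 <= `|a| * j%:R by exact: mulr_ge0.
by nra.
Qed.

(** The coefficients for a = d+1 are products of 1 + d/(j+1), hence at least
    1 + d times a harmonic sum. *)
Lemma negbin_unbounded d : 0 < d -> forall M, exists n, M < negbin (d + 1) n.
Proof.
move=> d0 M.
have lb n : 1 + d * series (@harmonic R) n <= negbin (d + 1) n.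
  elim: n => [|n IH].
    by rewrite negbin0 /series/= big_geq// mulr0 addr0.
  rewrite negbinS seriesSr/= mulrDr addrA.
  have -> : (d + 1 + n%:R) / n.+1%:R = 1 + d * n.+1%:R^-1.
    by rewrite -natr1; field; rewrite natr1 pnatr_eq0.
  rewrite mulrDr mulr1 lerD// ler_peMl ?mulr_ge0 ?invr_ge0 ?(ltW d0)//.
  apply: (le_trans _ IH); rewrite lerDl mulr_ge0 ?(ltW d0)//.
  by rewrite sumr_ge0// => i _; exact: harmonic_ge0.
apply: contrapT => nM; apply: (@dvg_harmonic R).
apply: nondecreasing_is_cvgn.
  apply/nondecreasing_seqP => n; rewrite seriesSr lerDl; exact: harmonic_ge0.
exists ((M - 1) / d) => _ [n _ <-].
rewrite ler_pdivlMr// lerBrDl mulrC (le_trans (lb n))//.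
by rewrite leNgt; apply/negP => ?; apply: nM; exists n.
Qed.

Lemma exprn_le_expR (y : R) n : 0 <= y -> y ^+ n <= n`!%:R * expR y.
Proof.
move=> y0; case: n => [|n]; first by rewrite expr0 mul1r -expR0 ler_expR.
rewrite mulrC -ler_pdivrMr ?ltr0n ?fact_gt0//.
by apply: le_trans (expR_ge1Dxn n y0); rewrite lerDr.
Qed.

(** With l <= e^(-2x), half of the exponential decay absorbs the polynomial
    factor. *)
Lemma is_cvg_poly_geometric (M : nat) (l : R) : 0 <= l < 1 ->
  cvgn (series (fun k => k.+1%:R ^+ M * l ^+ k)).
Proof.
move=> /andP[l0 l1]; set x := (1 - l) / 2.
have x0 : 0 < x by rewrite /x; lra.
pose C := x ^- M * M`!%:R * expR x.
apply: (@series_le_cvg _ _ (fun k => C * expR (- x) ^+ k)).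
- by move=> k; rewrite mulr_ge0 ?exprn_ge0.
- by move=> k; rewrite !mulr_ge0 ?exprn_ge0 ?invr_ge0 ?exprn_ge0 ?expR_ge0// ltW.
- move=> k.
  have le1 : l ^+ k <= expR (- (2 * x)) ^+ k.
    rewrite lerXn2r ?nnegrE ?expR_ge0//.
    by apply: le_trans (expR_ge1Dx _); rewrite /x; lra.
  have le2 : k.+1%:R ^+ M <= x ^- M * (M`!%:R * expR (x * k.+1%:R)).
    by rewrite ler_pdivlMl ?exprn_gt0// -exprMn exprn_le_expR// mulr_ge0// ltW.
  apply: (le_trans (ler_pM _ _ le2 le1)); rewrite ?exprn_ge0//.
  rewrite -!expRM_natr /C -!mulrA ler_pM2l ?invr_gt0 ?exprn_gt0//.
  rewrite ler_pM2l ?ltr0n ?fact_gt0// -!expRD ler_expR -(natr1 k).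
  by rewrite /x; lra.
- apply: is_cvg_geometric_series.
  by rewrite ger0_norm ?expR_ge0// expR_lt1 oppr_lt0.
Qed.

Lemma cvgn_scale (c : R) (u : R^nat) (x : R) :
  u @ \oo --> x -> (fun n => c * u n) @ \oo --> c * x.
Proof. by move=> ux; exact: cvgMr. Qed.

Lemma cvgn_add (u v : R^nat) (x y : R) :
  u @ \oo --> x -> v @ \oo --> y -> (fun n => u n + v n) @ \oo --> x + y.
Proof. by move=> ux vy; exact: cvgD. Qed.

Lemma cvgn_shift (u : R^nat) (x : R) :
  u @ \oo --> x -> (fun n => u n.+1) @ \oo --> x.
Proof. by move=> ux; have := ux; rewrite -cvg_shiftS. Qed.

Lemma cvgn_eq (u v : R^nat) (x y : R) :
  u @ \oo --> x -> v @ \oo --> y -> u =1 v -> x = y.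
Proof.
by move=> ux vy /funext uv; rewrite uv in ux; rewrite (cvg_unique _ ux vy).
Qed.

End NegBin.
Arguments cvgn_scale {R} c {u x} _.

(** * Coefficients of (1-z)^(a g - b) ((1-z)^a + l)^(-g) *)

Section Coefficients.
Variables (R : realType) (a l : R).
Hypotheses (a0 : 0 < a) (l0 : 0 < l) (l1 : l < 1).
Implicit Types (g b d : R).

(** Expanding ((1-z)^a + l)^(-g) in powers of l, the k-th term is
    (negbin g k) (-l)^k (1-z)^(-(b + a k)) once multiplied by (1-z)^(a g - b);
    this is its coefficient of z^n. *)
Definition rterm g b n k : R := negbin g k * (- l) ^+ k * negbin (b + a * k%:R) n.

Definition rcoef g b n : R := limn (series (rterm g b n)).

Lemma is_cvg_norm_rterm g b n : 0 <= g -> cvgn (series (fun k => `|rterm g b n k|)).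
Proof.
move=> g0; set m := (Num.truncn g).+1; set C := (1 + `|b| + a) ^+ n.
have gm : 0 <= g <= m%:R by rewrite g0 ltW// truncnS_gt.
apply: (@series_le_cvg _ _ (fun k => C * (k.+1%:R ^+ (m + n) * l ^+ k))).
- by move=> k.
- move=> k; rewrite !mulr_ge0 ?exprn_ge0 ?ler0n ?(ltW l0)//.
  by rewrite !addr_ge0// ltW.
- move=> k; rewrite !normrM normrX normrN (gtr0_norm l0).
  rewrite (ger0_norm (negbin_ge0 _ g0)).
  have le1 := negbin_le_poly k gm.
  have le2 : `|negbin (b + a * k%:R) n| <= C * k.+1%:R ^+ n.
    apply: (le_trans (normr_negbin_le _ _)).
    have b0 := normr_ge0 b; have k0 := ler0n R k.
    have bk0 := mulr_ge0 b0 k0; have ak0 := mulr_ge0 (ltW a0) k0.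
    have := ler_normD b (a * k%:R); rewrite (ger0_norm ak0) => h.
    have n0 := normr_ge0 (b + a * k%:R).
    rewrite -exprMn; apply: lerXn2r; rewrite ?nnegrE -?(natr1 k).
    + by lra.
    + by rewrite mulr_ge0 ?addr_ge0 ?(ltW a0).
    + by rewrite mulrDr mulr1 !mulrDl mul1r; have := ltW a0; lra.
  rewrite mulrAC [leRHS](_ : _ = k.+1%:R ^+ m * (C * k.+1%:R ^+ n) * l ^+ k); last first.
    by rewrite exprD; ring.
  rewrite ler_pM2r ?exprn_gt0//.
  by apply: ler_pM => //; exact: negbin_ge0.
- rewrite (_ : series _ = C \*: series (fun k => k.+1%:R ^+ (m + n) * l ^+ k)).
    by apply: is_cvgZr; apply: is_cvg_poly_geometric; rewrite l1 ltW.
  by apply/funext => N; rewrite /series/= scaler_sumr.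
Qed.

Lemma rcoef_cvg g b n : 0 <= g -> series (rterm g b n) @ \oo --> rcoef g b n.
Proof. by move=> g0; apply: normed_cvg; exact: is_cvg_norm_rterm. Qed.

(** Multiplication by (1-z)^(-d). *)
Lemma rcoef_conv g b d n : 0 <= g ->
  rcoef g (b + d) n = \sum_(i < n.+1) negbin d i * rcoef g b (n - i).
Proof.
move=> g0.
have h : \sum_(i < n.+1) negbin d i * series (rterm g b (n - i)%N) N @[N --> \oo]
    --> \sum_(i < n.+1) negbin d i * rcoef g b (n - i).
  by apply: cvg_big => [|i _]; [exact: add_continuous|]; apply: cvgMr; exact: rcoef_cvg.
apply: (cvgn_eq (@rcoef_cvg g (b + d) n g0) h) => N.
under [RHS]eq_bigr do rewrite /series/= mulr_sumr.
rewrite exchange_big/=; apply: eq_bigr => k _.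
rewrite /rterm (_ : b + d + a * k%:R = d + (b + a * k%:R)); last by ring.
rewrite negbin_vandermonde mulr_sumr; apply: eq_bigr => i _; ring.
Qed.

(** Differentiation of ((1-z)^a + l)^(-g); the equality already holds term by
    term. *)
Lemma rcoef_derive g n : 0 <= g ->
  n.+1%:R * rcoef g (a * g) n.+1 = a * g * rcoef (g + 1) (a * g + 1) n.
Proof.
move=> g0; have g10 : 0 <= g + 1 by rewrite addr_ge0.
have h := cvgn_scale (n.+1%:R) (@rcoef_cvg g (a * g) n.+1 g0).
have h2 := cvgn_scale (a * g) (@rcoef_cvg (g + 1) (a * g + 1) n g10).
apply: (cvgn_eq h h2) => N.
rewrite /series/= !mulr_sumr; apply: eq_bigr => k _; rewrite /rterm.
have e1 := negbin_derive (a * g + a * k%:R) n.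
have e2 := negbin_shift g k.
rewrite (_ : a * g + 1 + a * k%:R = a * g + a * k%:R + 1); last by ring.
set P := negbin (_ + 1) n in e1 *.
apply: esym; transitivity (a * ((g + k%:R) * negbin g k) * (- l) ^+ k * P).
  by rewrite e2; ring.
transitivity ((a * g + a * k%:R) * P * (negbin g k * (- l) ^+ k)); first by ring.
by rewrite -e1; ring.
Qed.

(** Factor one copy of (1-z)^a + l out of the power -g. *)
Lemma rcoef_lift g b n : 0 <= g ->
  rcoef g b n = rcoef (g + 1) b n + l * rcoef (g + 1) (b + a) n.
Proof.
move=> g0; have g10 : 0 <= g + 1 by rewrite addr_ge0.
have h := cvgn_shift (@rcoef_cvg g b n g0).
have h1 := cvgn_shift (@rcoef_cvg (g + 1) b n g10).
have h2 := cvgn_scale (l) (@rcoef_cvg (g + 1) (b + a) n g10).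
apply: (cvgn_eq h (cvgn_add h1 h2)) => N.
rewrite /series/= !big_nat_recl//= mulr_sumr -addrA -big_split/=; congr (_ + _).
  by rewrite /rterm !negbin0.
apply: eq_bigr => k _; rewrite /rterm negbin_pascal.
rewrite (_ : b + a + a * k%:R = b + a * k.+1%:R); last by rewrite -natr1; ring.
by rewrite exprS; ring.
Qed.

(** The constant coefficient, that is (1+l)^(-g). Its sign and its recursion
    in g start the inductions below. *)
Definition rbase g : R := rcoef g 0 0.

Lemma rcoef0 g b : rcoef g b 0 = rbase g.
Proof.
by congr (limn (series _)); apply/funext => k; rewrite /rterm !negbin0.
Qed.

Lemma rbaseS g : 0 <= g -> rbase g = (1 + l) * rbase (g + 1).
Proof. by move=> g0; rewrite /rbase rcoef_lift// !rcoef0; ring. Qed.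

Lemma alternating_series_bound (u : nat -> R) N :
  (forall k, 0 <= u k) -> (forall k, u k.+1 <= u k) ->
  0 <= \sum_(k < N) (-1) ^+ k * u k <= u 0%N.
Proof.
elim: N u => [|N IH] u u0 du; first by rewrite big_ord0 lexx u0.
rewrite big_ord_recl/= expr0 mul1r.
have -> : \sum_(i < N) (-1) ^+ bump 0 i * u (bump 0 i) =
    - \sum_(i < N) (-1) ^+ i * u i.+1.
  by rewrite -sumrN; apply: eq_bigr => i _; rewrite /bump/= add1n exprS; ring.
have /andP[h1 h2] := IH (fun k => u k.+1) (fun k => u0 _) (fun k => du _).
have := du 0%N; lra.
Qed.

(** For g <= 1 the binomial series is alternating with nonincreasing terms. *)
Lemma rbase_gt0_le1 g : 0 < g <= 1 -> 0 < rbase g.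
Proof.
move=> /andP[g0 g1].
pose u k := negbin g k * l ^+ k.
have u0 k : 0 <= u k by rewrite mulr_ge0 ?negbin_ge0 ?exprn_ge0// ltW.
have du k : u k.+1 <= u k.
  rewrite /u negbinS exprS.
  have -> : negbin g k * ((g + k%:R) / k.+1%:R) * (l * l ^+ k) =
    (negbin g k * l ^+ k) * ((g + k%:R) / k.+1%:R * l) by ring.
  rewrite ler_piMr ?u0// mulr_ile1 ?(ltW l0) ?(ltW l1)//.
    by rewrite divr_ge0// addr_ge0// ltW.
  by rewrite ler_pdivrMr ?ltr0Sn// mul1r -natr1 addrC lerD2l.
apply: (@lt_le_trans _ _ (1 - l)); first by rewrite subr_gt0.
have h := cvgn_shift (@rcoef_cvg g 0 0 (ltW g0)).
apply: (cvgr_to_ge h); apply: nearW => N.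
rewrite /series/= big_mkord big_ord_recl/=.
rewrite {1}/rterm !negbin0 expr0 !mulr1.
have -> : \sum_(i < N) rterm g 0 0 (bump 0 i) = - \sum_(i < N) (-1) ^+ i * u i.+1.
  rewrite -sumrN; apply: eq_bigr => i _.
  by rewrite /bump/= add1n /rterm negbin0 /u -[- l]mulN1r exprMn exprS; ring.
have /andP[_] := alternating_series_bound N (fun k => u0 k.+1) (fun k => du k.+1).
rewrite /u negbinS negbin0 expr1 addr0 divr1 mul1r => h2.
have : g * l <= l by rewrite ler_piMl// ltW.
by lra.
Qed.

Lemma rbase_gt0 g : 0 < g -> 0 < rbase g.
Proof.
move=> g0.
have [m gm] : exists m : nat, g <= m.+1%:R.
  by exists (Num.truncn g); rewrite ltW// truncnS_gt.
elim: m g g0 gm => [|m IH] g g0 gm; first by rewrite rbase_gt0_le1// g0.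
have [g1|g1] := leP g 1; first by rewrite rbase_gt0_le1// g0.
have h : 0 < rbase (g - 1).
  by apply: IH; [rewrite subr_gt0|rewrite lerBlDr natr1].
move: h; rewrite rbaseS ?subrK; last by rewrite subr_ge0 ltW.
by rewrite pmulr_rgt0// addr_gt0.
Qed.

(** The recursion behind the positivity proof: (1-z)^(a-1) is split off so that
    the second factor is again of the form b = a g, with g+1 instead of g. *)
Lemma rcoef_deriveS g n : 0 <= g ->
  n.+1%:R * rcoef g (a * g) n.+1 = a * g *
   \sum_(i < n.+1) negbin (1 - a) i * rcoef (g + 1) (a * (g + 1)) (n - i).
Proof.
move=> g0; rewrite rcoef_derive// -rcoef_conv ?addr_ge0//.
by congr (_ * rcoef _ _ _); ring.
Qed.

Hypothesis a1 : a <= 1.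
Let a1' : 0 <= 1 - a. Proof. by rewrite subr_ge0. Qed.

Lemma rcoef_ge0_crit g n : 0 < g -> 0 <= rcoef g (a * g) n.
Proof.
elim/ltn_ind: n g => -[_|n IH] g g0; first by rewrite rcoef0 ltW// rbase_gt0.
rewrite -(@pmulr_rge0 _ n.+1%:R) ?ltr0Sn// rcoef_deriveS ?(ltW g0)//.
rewrite !mulr_ge0 ?(ltW a0) ?(ltW g0)//; apply: sumr_ge0 => i _.
rewrite mulr_ge0 ?negbin_ge0// IH ?addr_gt0//.
by rewrite ltnS leq_subr.
Qed.

Lemma rcoef_ge0 g b n : 0 < g -> a * g <= b -> 0 <= rcoef g b n.
Proof.
move=> g0 gb; rewrite -[b](subrKC (a * g)) rcoef_conv ?(ltW g0)//.
apply: sumr_ge0 => i _; rewrite mulr_ge0 ?negbin_ge0 ?subr_ge0//.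
exact: rcoef_ge0_crit.
Qed.

(** After normalization by the constant coefficients, the coefficients are
    nondecreasing in g: the recursion has the nonnegative weights
    a g (negbin (1-a) i), which increase with g, and it preserves the
    normalizing ratio because of [rbaseS]. *)
Lemma rcoef_compare g g' n : 0 < g -> g <= g' ->
  rcoef g (a * g) n * rbase g' <= rcoef g' (a * g') n * rbase g.
Proof.
elim/ltn_ind: n g g' => -[_|n IH] g g' g0 gg'.
  by rewrite !rcoef0 mulrC.
have g'0 : 0 < g' by exact: lt_le_trans gg'.
rewrite -(@ler_pM2l _ n.+1%:R) ?ltr0Sn// !mulrA !rcoef_deriveS ?(ltW g0) ?(ltW g'0)//.
rewrite (rbaseS (ltW g0)) (rbaseS (ltW g'0)).
set S := \sum_(i < _) _; set S' := \sum_(i < _) _.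
have S0 : 0 <= S * rbase (g' + 1).
  rewrite mulr_ge0 ?(ltW (rbase_gt0 _)) ?addr_gt0//.
  apply: sumr_ge0 => i _.
  by rewrite mulr_ge0 ?negbin_ge0// rcoef_ge0_crit// addr_gt0.
have SS' : S * rbase (g' + 1) <= S' * rbase (g + 1).
  rewrite !mulr_suml; apply: ler_sum => i _.
  rewrite -!mulrA ler_wpM2l ?negbin_ge0//.
  by apply: IH; rewrite ?addr_gt0 ?lerD2r// ltnS leq_subr.
have -> : a * g * S * ((1 + l) * rbase (g' + 1)) =
  (a * (1 + l)) * (g * (S * rbase (g' + 1))) by ring.
have -> : a * g' * S' * ((1 + l) * rbase (g + 1)) =
  (a * (1 + l)) * (g' * (S' * rbase (g + 1))) by ring.
rewrite ler_pM2l ?mulr_gt0 ?addr_gt0//.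
by apply: ler_pM => //; exact: ltW.
Qed.

(** Partial sums are the coefficients of the product with 1/(1-z). *)
Lemma sum_rcoef g b N : 0 <= g -> \sum_(n < N.+1) rcoef g b n = rcoef g (b + 1) N.
Proof.
move=> g0; rewrite rcoef_conv//.
rewrite [RHS](reindex_inj rev_ord_inj)/=.
apply: eq_bigr => i _; rewrite negbin1 mul1r subSS subKn//.
by rewrite -ltnS.
Qed.

(** At z = 1 the series ((1-z)^a + l)^(-m) would be l^(-m). Going from m to m+1
    divides the partial sums by at least l, since the other summand of
    [rcoef_lift] is nonnegative. *)
Lemma rcoef_nat_le m N : rcoef m%:R (a * m%:R + 1) N <= l ^- m.
Proof.
elim: m => [|m IH].
  rewrite expr0 invr1 mulr0 add0r.
  have h := cvgn_shift (@rcoef_cvg 0 1 N (lexx 0)).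
  apply: (cvgr_to_le h); apply: nearW => n.
  rewrite /series/= big_nat_recl// big1 ?addr0.
    by rewrite /rterm negbin0 expr0 mulr0 addr0 negbin1 !mul1r.
  by move=> i _; rewrite /rterm negbin_0S !mul0r.
have m0 : 0 <= m%:R :> R by [].
move: IH; rewrite (rcoef_lift _ _ m0) natr1.
have : 0 <= rcoef m.+1%:R (a * m%:R + 1) N.
  apply: rcoef_ge0; first by rewrite ltr0Sn.
  by rewrite -(natr1 m) mulrDr mulr1 lerD2l.
rewrite (_ : a * m%:R + 1 + a = a * m.+1%:R + 1); last by rewrite -natr1; ring.
move=> h1 h2; rewrite exprS invfM ler_pdivlMl//.
by apply: le_trans h2; rewrite lerDr.
Qed.

(** Otherwise the partial sums for b = a g would be at least a multiple of
    negbin (d+1) N, with d = a g - b, although they are bounded. *)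
Lemma rcoef_not_ge0 g b : 0 < g -> b < a * g -> ~ (forall n, 0 <= rcoef g b n).
Proof.
move=> g0 bg P; have g0' := ltW g0.
set m := (Num.truncn g).+1.
have gm : g <= m%:R by rewrite ltW// truncnS_gt.
have Bm0 : 0 < rbase m%:R by rewrite rbase_gt0// ltr0Sn.
have Bg0 := rbase_gt0 g0.
set d := a * g - b; have d0 : 0 < d by rewrite subr_gt0.
have [N] := negbin_unbounded d0 (l ^- m / rbase m%:R).
rewrite ltr_pdivrMr//; apply/negP; rewrite -leNgt.
rewrite -(ler_pM2r Bg0).
apply: (@le_trans _ _ (\sum_(n < N.+1) rcoef g (a * g) n * rbase m%:R)).
  rewrite -mulr_suml mulrAC ler_pM2r//.
  rewrite sum_rcoef// (_ : a * g + 1 = b + (d + 1)); last by rewrite /d; ring.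
  rewrite rcoef_conv// big_ord_recr/= subnn rcoef0 lerDr.
  apply: sumr_ge0 => i _; rewrite mulr_ge0// negbin_ge0// addr_ge0//.
  exact: ltW.
apply: (@le_trans _ _ (\sum_(n < N.+1) rcoef m%:R (a * m%:R) n * rbase g)).
  by apply: ler_sum => n _; exact: rcoef_compare.
rewrite -mulr_suml ler_pM2r// sum_rcoef//; exact: rcoef_nat_le.
Qed.

End Coefficients.

(** * Convergence and derivative of the Prabhakar series *)

Section Prabhakar.
Variable R : realType.
Implicit Types (al be ga x z s t : R).

Lemma GammaDn s n : 0 < s -> Gamma (s + n%:R) = n`!%:R * negbin s n * Gamma s.
Proof.
move=> s0; elim: n => [|n IH]; first by rewrite addr0 negbin0 fact0 !mul1r.
rewrite -(natr1 n) addrA GammaD1; last by rewrite ltr_wpDr.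
rewrite IH negbinS factS natrM; field.
by rewrite addrC natr1 pnatr_eq0.
Qed.

Lemma prabhakar_coeffE al be ga n : 0 < ga ->
  prabhakar_coeff al be ga n = negbin ga n / Gamma (be + al * n%:R).
Proof.
move=> ga0; rewrite /prabhakar_coeff GammaDn//.
set G := Gamma ga; have G0 : G != 0 by rewrite gt_eqF// Gamma_gt0.
set H := Gamma (be + _).
set F : R := n`!%:R; have F0 : F != 0 by rewrite pnatr_eq0 -lt0n fact_gt0.
rewrite !invfM; move: H^-1 => {}H.
by field; rewrite G0 F0.
Qed.

Lemma prabhakar_coeff_gt0 al be ga n : 0 < al -> 0 < be -> 0 < ga ->
  0 < prabhakar_coeff al be ga n.
Proof.
move=> a0 b0 g0; rewrite prabhakar_coeffE// divr_gt0 ?negbin_gt0// Gamma_gt0//.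
by rewrite ltr_wpDr// mulr_ge0// ltW.
Qed.

Lemma Gamma_lower_bound s x : 0 < s -> 0 < x ->
  x `^ s * expR (- (x + 1)) <= s * Gamma s.
Proof.
move=> s0 x0; rewrite -GammaD1//.
have s1 : 1 <= s + 1 by rewrite lerDr ltW.
by have := Gamma_ge_powR s1 x0; rewrite addrK.
Qed.

Lemma prabhakar_coeff_le al be ga x n : 0 < al -> 0 < be -> 0 < ga -> 0 < x ->
  prabhakar_coeff al be ga n <=
  (be + al) * n.+1%:R * (1 + ga) ^+ n * (x `^ (- be) * expR (x + 1) * (x `^ (- al)) ^+ n).
Proof.
move=> a0 b0 g0 x0; rewrite prabhakar_coeffE//.
have an0 : 0 <= al * n%:R by rewrite mulr_ge0// ltW.
set s := be + al * n%:R; have s0 : 0 < s by rewrite /s; lra.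
have G0 := Gamma_gt0 s0.
have le1 : negbin ga n <= (1 + ga) ^+ n.
  by have := normr_negbin_le ga n; rewrite !ger0_norm// ?negbin_ge0 ?(ltW g0).
have le2 : s <= (be + al) * n.+1%:R.
  rewrite /s -(natr1 n) mulrDr mulr1 mulrDl.
  have : 0 <= be * n%:R by rewrite mulr_ge0// ltW.
  lra.
have P0 : 0 < x `^ s * expR (- (x + 1)) by rewrite mulr_gt0 ?powR_gt0 ?expR_gt0.
have le3 : (Gamma s)^-1 <= s * (x `^ (- be) * expR (x + 1) * (x `^ (- al)) ^+ n).
  have -> : x `^ (- be) * expR (x + 1) * (x `^ (- al)) ^+ n =
      (x `^ s * expR (- (x + 1)))^-1.
    rewrite invfM expRN invrK -powRN -powR_mulrn ?powR_ge0// -powRrM.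
    rewrite mulrAC -powRD ?(gt_eqF x0) ?implybT//.
    by congr (_ `^ _ * _); rewrite /s; ring.
  rewrite ler_pdivlMr// mulrC ler_pdivrMr//; exact: Gamma_lower_bound.
have W0 : 0 <= x `^ (- be) * expR (x + 1) * (x `^ (- al)) ^+ n.
  by rewrite !mulr_ge0 ?exprn_ge0 ?powR_ge0 ?expR_ge0.
apply: (@le_trans _ _ ((1 + ga) ^+ n *
    (s * (x `^ (- be) * expR (x + 1) * (x `^ (- al)) ^+ n)))).
  by apply: ler_pM => //; [exact: negbin_ge0 (ltW g0)|rewrite invr_ge0 ltW].
rewrite mulrCA -[leRHS]mulrA -[leRHS]mulrA [leRHS](_ : _ =
  (be + al) * n.+1%:R * ((1 + ga) ^+ n * (x `^ (- be) * expR (x + 1) * (x `^ (- al)) ^+ n))); last by ring.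
by rewrite ler_wpM2r// mulr_ge0// exprn_ge0// addr_ge0// ltW.
Qed.

(** The base x of the Gamma lower bound is chosen with x^al = y large enough to
    beat (1+ga)|z| by a factor 2. *)
Lemma is_cvg_prabhakar_abs al be ga z : 0 < al -> 0 < be -> 0 < ga ->
  cvgn (series (fun n => `|prabhakar_coeff al be ga n * z ^+ n|)).
Proof.
move=> a0 b0 g0.
pose y := 2 * (1 + ga) * (`|z| + 1).
have z0 := normr_ge0 z.
have y0 : 0 < y by rewrite !mulr_gt0//; lra.
pose x := y `^ al^-1.
have x0 : 0 < x by rewrite powR_gt0.
have xy : x `^ (- al) = y^-1.
  by rewrite powRN /x -powRrM mulVf ?gt_eqF// powRr1// ltW.
pose C := (be + al) * (x `^ (- be) * expR (x + 1)).
have C0 : 0 <= C.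
  by rewrite !mulr_ge0 ?powR_ge0 ?expR_ge0 ?addr_ge0 ?(ltW a0) ?(ltW b0).
apply: (@series_le_cvg _ _ (fun n => C * (n.+1%:R ^+ 1 * (2^-1) ^+ n))).
- by move=> n.
- by move=> n; apply: mulr_ge0 => //; rewrite mulr_ge0 ?exprn_ge0.
- move=> n; rewrite normrM normrX ger0_norm; last exact/ltW/prabhakar_coeff_gt0.
  have h := prabhakar_coeff_le n a0 b0 g0 x0.
  apply: (le_trans (ler_wpM2r (exprn_ge0 n z0) h)).
  rewrite xy expr1.
  have -> : (be + al) * n.+1%:R * (1 + ga) ^+ n *
    (x `^ (- be) * expR (x + 1) * y^-1 ^+ n) * `|z| ^+ n =
    C * (n.+1%:R * ((1 + ga) * y^-1 * `|z|) ^+ n) by rewrite /C !exprMn; ring.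
  rewrite ler_wpM2l// ler_wpM2l// lerXn2r ?nnegrE//.
    by rewrite !mulr_ge0 ?invr_ge0 ?(ltW y0)// addr_ge0// ltW.
  rewrite mulrAC ler_pdivrMr// /y.
  have -> : 2^-1 * (2 * (1 + ga) * (`|z| + 1)) = (1 + ga) * (`|z| + 1) by field.
  by rewrite ler_pM2l ?addr_gt0// lerDl.
- rewrite (_ : series _ = C \*: series (fun n => n.+1%:R ^+ 1 * 2^-1 ^+ n)).
    by apply: is_cvgZr; apply: is_cvg_poly_geometric; apply/andP; split; lra.
  by apply/funext => N; rewrite /series/= scaler_sumr.
Qed.

Lemma prabhakar_is_cvg al be ga z : 0 < al -> 0 < be -> 0 < ga ->
  cvgn (pseries (prabhakar_coeff al be ga) z).
Proof. by move=> *; apply: normed_cvg; exact: is_cvg_prabhakar_abs. Qed.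

Lemma prabhakar_diffs al be ga : 0 < ga ->
  pseries_diffs (prabhakar_coeff al be ga) =
  (fun n => ga * prabhakar_coeff al (be + al) (ga + 1) n).
Proof.
move=> g0; have g10 : 0 < ga + 1 by rewrite addr_gt0.
apply/funext => n; rewrite /pseries_diffs.
rewrite (prabhakar_coeffE _ _ _ g0) (prabhakar_coeffE _ _ _ g10).
rewrite !mulrA negbin_derive; congr (_ * _ / Gamma _).
by rewrite -(natr1 n); ring.
Qed.

Lemma pseriesZ c (u : R^nat) z : pseries (fun n => c * u n) z = (fun N => c * pseries u z N).
Proof.
apply/funext => N; rewrite /pseries /series/= mulr_sumr.
by apply: eq_bigr => i _; rewrite mulrA.
Qed.

Lemma is_derive_prabhakar al be ga z : 0 < al -> 0 < be -> 0 < ga ->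
  is_derive z 1 (prabhakar al be ga) (ga * prabhakar al (be + al) (ga + 1) z).
Proof.
move=> a0 b0 g0.
have ba0 : 0 < be + al by lra.
have baa0 : 0 < be + al + al by lra.
have g10 : 0 < ga + 1 by lra.
have g20 : 0 < ga + 1 + 1 by lra.
have cz c be' ga' w : 0 < be' -> 0 < ga' ->
    cvgn (pseries (fun n => c * prabhakar_coeff al be' ga' n) w).
  move=> b'0 g'0; rewrite pseriesZ; apply: is_cvgMr; exact: prabhakar_is_cvg.
have -> : ga * prabhakar al (be + al) (ga + 1) z =
    limn (pseries (pseries_diffs (prabhakar_coeff al be ga)) z).
  rewrite prabhakar_diffs// pseriesZ; apply/esym/cvg_lim => //.
  apply: cvgn_scale; exact: prabhakar_is_cvg.
apply: (@pseries_snd_diffs _ _ (`|z| + 1)).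
- exact: prabhakar_is_cvg.
- by rewrite prabhakar_diffs//; exact: cz.
- rewrite prabhakar_diffs//.
  rewrite (_ : pseries_diffs _ = (fun n => (ga * (ga + 1)) *
    prabhakar_coeff al (be + al + al) (ga + 1 + 1) n)); first exact: cz.
  apply/funext => n; have /(congr1 (fun f => f n)) := prabhakar_diffs al (be + al) g10.
  by rewrite /pseries_diffs => e; rewrite -!mulrA -e mulrCA.
- by rewrite [X in _ < X]ger0_norm ?addr_ge0// ltrDl.
Qed.

End Prabhakar.

(** * Positivity by passing to the limit in the coefficients *)

Section Positivity.
Variable R : realType.
Implicit Types (al be ga x s t b : R).

(** Tannery's theorem, restricted to signs: a limit of dominated series with
    nonnegative sums has a nonnegative sum. *)
Lemma tannery_ge0 (T : nat -> R^nat) (u D : R^nat) (S : R) n0 :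
  (forall n k, (n0 <= n)%N -> `|T n k| <= D k) -> cvgn (series D) ->
  (forall k, T n k @[n --> \oo] --> u k) ->
  (forall n, (n0 <= n)%N -> exists2 s : R, 0 <= s & series (T n) @ \oo --> s) ->
  series u @ \oo --> S -> 0 <= S.
Proof.
move=> TD cD Tu Ts uS.
have D0 k : 0 <= D k by apply: le_trans (TD n0 k (leqnn _)).
have ndD : nondecreasing_seq (series D).
  by apply/nondecreasing_seqP => n; rewrite seriesSr lerDl.
pose tail K := limn (series D) - series D K.
have tail_cvg : tail @ \oo --> (0 : R).
  by rewrite -(subrr (limn (series D))); apply: cvgB => //; exact: cvg_cst.
have step1 n K : (n0 <= n)%N -> 0 <= series (T n) K + tail K.
  move=> nn; have [s s0 Tns] := Ts n nn; apply: (le_trans s0).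
  apply: (cvgr_to_le Tns); exists K => // N /= KN.
  rewrite -lerBlDl (sub_series_geq _ KN).
  apply: (@le_trans _ _ (series D N - series D K)); last first.
    by rewrite lerD2r; exact: nondecreasing_cvgn_le.
  rewrite (sub_series_geq _ KN); apply: ler_sum => k _.
  exact: le_trans (ler_norm _) (TD _ _ nn).
have step2 K : 0 <= series u K + tail K.
  have h : (fun n => series (T n) K + tail K) @ \oo --> series u K + tail K.
    apply: cvgn_add; last exact: cvg_cst.
    by apply: cvg_big => [|k _]; [exact: add_continuous|exact: Tu].
  by apply: (cvgr_to_ge h); exists n0 => // n /= nn; exact: step1.
have h := cvgn_add uS tail_cvg; rewrite addr0 in h.
by apply: (cvgr_to_ge h); exact: nearW.
Qed.

Definition Gamma_ratio s b : R := Gamma (s + b) / (Gamma s * s `^ b).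

Lemma Gamma_ratio_ge0 s b : 0 < s -> 0 <= b -> 0 <= Gamma_ratio s b.
Proof.
move=> s0 b0; apply: divr_ge0; first by apply/ltW/Gamma_gt0; rewrite ltr_wpDr.
by apply: mulr_ge0; [exact/ltW/Gamma_gt0|exact: powR_ge0].
Qed.

Lemma Gamma_ratio_le1 s b : 0 < s -> 0 <= b <= 1 -> Gamma_ratio s b <= 1.
Proof.
move=> s0 b01; rewrite ler_pdivrMr; last by rewrite mulr_gt0 ?powR_gt0 ?Gamma_gt0.
by rewrite mul1r mulrC; exact: Gamma_wendel.
Qed.

Lemma Gamma_ratio_ge s b : 0 < s -> 0 <= b <= 1 -> s / (s + b) <= Gamma_ratio s b.
Proof.
move=> s0 b01; rewrite ler_pdivlMr; last by rewrite mulr_gt0 ?powR_gt0 ?Gamma_gt0.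
by rewrite (mulrC (Gamma s)); exact: Gamma_wendel_ge.
Qed.

(** The quotient of the two sides is (1 + b/s) / (1 + 1/s)^b, at most 1 by
    Bernoulli's inequality. *)
Lemma Gamma_ratio_succ_le s b : 0 < s -> 1 <= b ->
  Gamma_ratio (s + 1) b <= Gamma_ratio s b.
Proof.
move=> s0 b1; have b0 : 0 < b by lra.
have s10 : 0 < s + 1 by lra.
have sb0 : 0 < s + b by lra.
rewrite /Gamma_ratio (_ : s + 1 + b = s + b + 1); last by ring.
rewrite (GammaD1 sb0) (GammaD1 s0).
have G0 := Gamma_gt0 s0; have Gb0 := Gamma_gt0 sb0.
move: (Gamma s) (Gamma (s + b)) G0 Gb0 => G H G0 H0.
have P0 : 0 < s `^ b by rewrite powR_gt0.
have Q0 : 0 < (s + 1) `^ b by rewrite powR_gt0.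
suff key : (s + b) * s `^ b <= s * (s + 1) `^ b.
  rewrite ler_pdivrMr; last by rewrite !mulr_gt0.
  rewrite mulrAC ler_pdivlMr ?mulr_gt0//.
  have -> : (s + b) * H * (G * s `^ b) = H * G * ((s + b) * s `^ b) by ring.
  have -> : H * (s * G * (s + 1) `^ b) = H * G * (s * (s + 1) `^ b) by ring.
  by rewrite ler_pM2l ?mulr_gt0.
have ib : 0 <= b^-1 <= 1 by rewrite invr_ge0 (ltW b0)/= invf_le1.
have := powR_le_tangent ib sb0 s0.
have -> : 1 - b^-1 + b^-1 * ((s + b) / s) = 1 + s^-1.
  by field; rewrite !gt_eqF.
move=> h.
have i0 : 0 < 1 + s^-1 by rewrite addr_gt0// invr_gt0.
have {h} : ((s + b) `^ b^-1) `^ b <= (s `^ b^-1 * (1 + s^-1)) `^ b.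
  by apply: ge0_ler_powR => //; rewrite ?nnegrE ?mulr_ge0 ?powR_ge0 ?(ltW b0) ?(ltW i0).
rewrite powRM ?powR_ge0 ?(ltW i0)// -!powRrM mulVf ?gt_eqF// !powRr1 ?(ltW s0) ?(ltW sb0)//.
move=> h.
have -> : (s + 1) `^ b = s `^ b * (1 + s^-1) `^ b.
  rewrite -powRM ?(ltW s0) ?(ltW i0)//; congr (_ `^ _).
  by rewrite mulrDr mulr1 mulfV ?gt_eqF.
by rewrite mulrCA [leRHS]mulrC ler_pM2r.
Qed.

(** Uniformity in n, which makes a convergent series for one value n0 dominate
    all later ones. *)
Lemma Gamma_ratio_bound s b n0 n : 0 < s -> 0 <= b -> (n0 <= n)%N ->
  Gamma_ratio (s + n%:R) b <= 1 + Gamma_ratio (s + n0%:R) b.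
Proof.
move=> s0 b0 nn.
have sn m : 0 < s + m%:R by rewrite ltr_wpDr.
have [b1|/ltW b1] := leP b 1.
  apply: (@le_trans _ _ 1); first by apply: Gamma_ratio_le1 => //; rewrite b0.
  by rewrite lerDl Gamma_ratio_ge0.
apply: (@le_trans _ _ (Gamma_ratio (s + n0%:R) b)); last by rewrite lerDr.
rewrite -(subnKC nn); elim: (n - n0)%N => [|m IH]; first by rewrite addn0.
apply: le_trans IH; rewrite addnS -natr1 addrA.
exact: Gamma_ratio_succ_le.
Qed.

(** Steps of length al <= 1, each within the range of Wendel's inequality. *)
Lemma Gamma_ratio_split s al k : 0 < s -> 0 <= al ->
  Gamma_ratio s (al * k.+1%:R) = Gamma_ratio s (al * k%:R) *
    (Gamma_ratio (s + al * k%:R) al * ((s + al * k%:R) / s) `^ al).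
Proof.
move=> s0 a0; have ak0 : 0 <= al * k%:R by rewrite mulr_ge0.
rewrite /Gamma_ratio -(natr1 k) mulrDr mulr1 addrA.
set t := s + al * k%:R; have t0 : 0 < t by rewrite /t; lra.
have -> : (t / s) `^ al = t `^ al / s `^ al.
  rewrite powRM ?invr_ge0 ?(ltW t0) ?(ltW s0)//; congr (_ * _).
  by rewrite -powR_inv1 ?(ltW s0)// -powRrM mulN1r powRN.
rewrite (powRD (x := s)) ?(gt_eqF s0) ?implybT//.
have : Gamma t != 0 by rewrite gt_eqF// Gamma_gt0.
have : Gamma s != 0 by rewrite gt_eqF// Gamma_gt0.
have : t `^ al != 0 by rewrite gt_eqF// powR_gt0.
have : s `^ al != 0 by rewrite gt_eqF// powR_gt0.
have : s `^ (al * k%:R) != 0 by rewrite gt_eqF// powR_gt0.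
move: (Gamma (t + al)) (Gamma t) (Gamma s) (t `^ al) (s `^ al) (s `^ _).
by move=> u1 u2 u3 u4 u5 u6 h1 h2 h3 h4 h5; field; rewrite h1 h2 h3 h4 h5.
Qed.

Lemma Gamma_ratio_cvg al be k : 0 < al <= 1 -> 0 < be ->
  Gamma_ratio (be + n%:R) (al * k%:R) @[n --> \oo] --> (1 : R).
Proof.
move=> /andP[a0 a1] b0; have a01 : 0 <= al <= 1 by rewrite ltW.
have sn m : 0 < be + m%:R by rewrite ltr_wpDr.
elim: k => [|k IH].
  rewrite (_ : (fun n => _) = fun=> 1); first exact: cvg_cst.
  apply/funext => n; rewrite /Gamma_ratio mulr0 addr0 powRr0 mulr1 divff//.
  by rewrite gt_eqF// Gamma_gt0.
have ak0 : 0 <= al * k%:R by rewrite mulr_ge0// ltW.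
pose q n := Gamma_ratio (be + n%:R + al * k%:R) al *
  ((be + n%:R + al * k%:R) / (be + n%:R)) `^ al.
suff hq : q @ \oo --> (1 : R).
  have h : (fun n => Gamma_ratio (be + n%:R) (al * k%:R) * q n) @ \oo --> (1 : R).
    by rewrite -[X in _ --> X](mulr1 1); exact: (cvgM IH hq).
  rewrite (_ : (fun n => _) =
    (fun n => Gamma_ratio (be + n%:R) (al * k%:R) * q n)); first exact: h.
  by apply/funext => n; rewrite (Gamma_ratio_split _ (sn n) (ltW a0)).
pose C := 1 + be^-1.
have C0 : 0 <= C by rewrite addr_ge0// invr_ge0 ltW.
(* compares s = be + n with n + 1, also when be < 1 *)
have invle n : (be + n%:R)^-1 <= C * @harmonic R n.
  rewrite /harmonic/= ler_pdivlMr ?ltr0Sn// ler_pdivrMl// /C -(natr1 n).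
  have -> : (be + n%:R) * (1 + be^-1) = be + n%:R + 1 + n%:R / be.
    by field; rewrite gt_eqF.
  have : 0 <= n%:R / be by rewrite divr_ge0// ltW.
  lra.
have hcvg c : (fun n => 1 + c * @harmonic R n) @ \oo --> (1 : R).
  have h1 := cvgn_scale c (@cvg_harmonic R).
  have h2 : (fun n => 1 + c * @harmonic R n) @ \oo --> 1 + c * 0.
    by apply: cvgn_add h1; exact: cvg_cst.
  by rewrite mulr0 addr0 in h2.
apply: (@squeeze_cvgr _ _ _ _ (fun n => 1 + (- (al * C)) * @harmonic R n)
  (fun n => 1 + (al * k%:R * C) * @harmonic R n)) => //.
apply: nearW => n; have s0 := sn n.
set s := be + n%:R in s0 *; set t := s + al * k%:R.
have t0 : 0 < t by rewrite /t; lra.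
have ts : 1 <= t / s by rewrite ler_pdivlMr// mul1r lerDl.
have r1 := Gamma_ratio_le1 t0 a01; have r0 := Gamma_ratio_ge t0 a01.
have p1 : 1 <= (t / s) `^ al by rewrite -(powRr0 (t / s)); apply: ler_powR => //; exact: ltW.
have p2 : (t / s) `^ al <= t / s by exact: ler1_powR.
have si := invle n; rewrite -/s in si.
have ti : t^-1 <= s^-1 by rewrite lef_pV2 ?posrE// lerDl.
have rpos : 0 <= Gamma_ratio t al by rewrite Gamma_ratio_ge0// ltW.
have si0 : 0 <= s^-1 by rewrite invr_ge0 ltW.
apply/andP; split.
  apply: (@le_trans _ _ (t / (t + al))); last first.
    by apply: (le_trans r0); rewrite ler_peMr.
  have ta0 : 0 < t + al by lra.
  have -> : t / (t + al) = 1 - al * (t + al)^-1 by field; rewrite gt_eqF.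
  rewrite mulNr lerD2l lerN2 -mulrA ler_pM2l//.
  apply: le_trans si; apply: le_trans ti.
  by rewrite lef_pV2 ?posrE// lerDl ltW.
apply: (@le_trans _ _ (t / s)).
  apply: le_trans p2; rewrite ler_piMl//; exact: powR_ge0.
have -> : t / s = 1 + al * k%:R * s^-1 by rewrite /t; field; rewrite gt_eqF.
by rewrite lerD2l -[leRHS]mulrA ler_wpM2l.
Qed.

(** The terms of the discrete model at l = x s^(-al) are those of E(-x), up to
    Gamma ratios that tend to 1. *)
Lemma rterm_Gamma_ratio al be ga x n k : 0 < al -> 0 < be -> 0 < ga ->
  let s := be + n%:R in
  n`!%:R / Gamma s * rterm al (x * s `^ (- al)) ga be n k =
  prabhakar_coeff al be ga k * (- x) ^+ k * Gamma_ratio s (al * k%:R).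
Proof.
move=> a0 b0 g0 s.
have s0 : 0 < s by rewrite ltr_wpDr.
have bk0 : 0 < be + al * k%:R by rewrite ltr_wpDr// mulr_ge0// ltW.
rewrite prabhakar_coeffE// /rterm /Gamma_ratio.
rewrite (_ : s + al * k%:R = be + al * k%:R + n%:R); last by rewrite /s; ring.
rewrite (GammaDn _ bk0).
have -> : (- (x * s `^ (- al))) ^+ k = (- x) ^+ k / s `^ (al * k%:R).
  by rewrite -mulNr exprMn -[(s `^ (- al)) ^+ k]powR_mulrn ?powR_ge0// -powRrM mulNr powRN.
have : Gamma s != 0 by rewrite gt_eqF// Gamma_gt0.
have : Gamma (be + al * k%:R) != 0 by rewrite gt_eqF// Gamma_gt0.
have : s `^ (al * k%:R) != 0 by rewrite gt_eqF// powR_gt0.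
move: (Gamma s) (Gamma _) (s `^ _) (negbin ga k) (negbin _ n) => u1 u2 u3 u4 u5 h1 h2 h3.
by field; rewrite h1 h2 h3.
Qed.

Lemma prabhakar_ge0 al be ga x : 0 < al <= 1 -> 0 < be -> 0 < ga ->
  al * ga <= be -> 0 < x -> 0 <= prabhakar al be ga (- x).
Proof.
move=> a01 b0 g0 agb x0; have /andP[a0 a1] := a01.
pose s n := be + n%:R : R.
have s0 n : 0 < s n by rewrite ltr_wpDr.
pose l n := x * s n `^ (- al).
have l0 n : 0 < l n by rewrite mulr_gt0// powR_gt0.
(* from n0 on, l n < 1 *)
have [n0 xn0] : exists n0 : nat, x `^ al^-1 < n0%:R.
  by exists (Num.truncn (x `^ al^-1)).+1; exact: truncnS_gt.
have l1 n : (n0 <= n)%N -> l n < 1.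
  move=> nn; rewrite /l powRN ltr_pdivrMr ?powR_gt0// mul1r.
  rewrite -{1}(powRr1 (ltW x0)) -(mulVf (lt0r_neq0 a0)) powRrM.
  apply: gt0_ltr_powR; rewrite ?nnegrE ?powR_ge0 ?(ltW (s0 _))//.
  apply: (lt_le_trans xn0); apply: (@le_trans _ _ n%:R); first by rewrite ler_nat.
  by rewrite lerDr ltW.
pose c k := prabhakar_coeff al be ga k.
have c0 k : 0 <= c k by exact/ltW/prabhakar_coeff_gt0.
pose T n k := c k * (- x) ^+ k * Gamma_ratio (s n) (al * k%:R).
(* dominates all indices n >= n0, by [Gamma_ratio_bound] *)
pose D k := `|c k * (- x) ^+ k| + `|T n0 k|.
have ak0 k : 0 <= al * k%:R by rewrite mulr_ge0// ltW.
have TE n : T n = (fun k => n`!%:R / Gamma (s n) * rterm al (l n) ga be n k).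
  by apply/funext => k; rewrite /T -rterm_Gamma_ratio.
have K0 n : 0 <= n`!%:R / Gamma (s n) by rewrite divr_ge0// ltW// Gamma_gt0.
apply: (@tannery_ge0 T (fun k => c k * (- x) ^+ k) D _ n0).
- move=> n k nn; rewrite /T /D /T !(normrM (c k * _)) -[X in X + _]mulr1 -mulrDr.
  rewrite ler_wpM2l// !ger0_norm ?Gamma_ratio_ge0//.
  exact: Gamma_ratio_bound.
- rewrite (_ : series D = series (fun k => `|c k * (- x) ^+ k|) +
    series (fun k => `|T n0 k|)); last by apply/funext => N; rewrite /series/= big_split.
  apply: is_cvgD; first exact: is_cvg_prabhakar_abs.
  rewrite TE.
  have -> : (fun k => `|n0`!%:R / Gamma (s n0) * rterm al (l n0) ga be n0 k|) =
      (fun k => n0`!%:R / Gamma (s n0) * `|rterm al (l n0) ga be n0 k|).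
    by apply/funext => k; rewrite normrM ger0_norm.
  rewrite (_ : series _ = fun N => n0`!%:R / Gamma (s n0) *
    series (fun k => `|rterm al (l n0) ga be n0 k|) N); last first.
    by apply/funext => N; rewrite /series/= mulr_sumr.
  apply: is_cvgMr; apply: is_cvg_norm_rterm => //; [exact: l1|exact: ltW].
- move=> k; have h := Gamma_ratio_cvg k a01 b0.
  by have := cvgn_scale (c k * (- x) ^+ k) h; rewrite mulr1.
- move=> n nn; exists (n`!%:R / Gamma (s n) * rcoef al (l n) ga be n).
    by rewrite mulr_ge0//; apply: rcoef_ge0 => //; exact: l1.
  rewrite TE (_ : series _ = fun N => n`!%:R / Gamma (s n) *
    series (rterm al (l n) ga be n) N); last first.
    by apply/funext => N; rewrite /series/= mulr_sumr.
  by apply: cvgn_scale; apply: rcoef_cvg => //; [exact: l1|exact: ltW].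
- exact: prabhakar_is_cvg.
Qed.

End Positivity.

(** * Integration of alternating series *)

Section AlternatingIntegral.
Variable R : realType.
Local Notation mu := (@lebesgue_measure R).
Local Notation Rpos := (`]0, +oo[%classic : set R).

Definition even_part (u : R^nat) : R^nat := fun k => if odd k then 0 else u k.
Definition odd_part (u : R^nat) : R^nat := fun k => if odd k then u k else 0.

Lemma is_cvg_even_part (u : R^nat) : (forall k, 0 <= u k) -> cvgn (series u) ->
  cvgn (series (even_part u)).
Proof. by move=> u0; apply: series_le_cvg => // k; rewrite /even_part; case: ifP. Qed.

Lemma is_cvg_odd_part (u : R^nat) : (forall k, 0 <= u k) -> cvgn (series u) ->
  cvgn (series (odd_part u)).
Proof. by move=> u0; apply: series_le_cvg => // k; rewrite /odd_part; case: ifP. Qed.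

Lemma eseries_EFin (u : R^nat) : cvgn (series u) ->
  (\sum_(k <oo) (u k)%:E = (limn (series u))%:E)%E.
Proof.
move=> cu; rewrite -EFin_lim//; congr (limn _).
by apply/funext => n; rewrite /= /series/= sumEFin.
Qed.

(** The sign of an alternating sum as a comparison of two sums of nonnegative
    terms, a form in which monotone convergence applies. *)
Lemma alternating_lim_ge0 (u : R^nat) : (forall k, 0 <= u k) -> cvgn (series u) ->
  (0 <= limn (series (fun k => (-1) ^+ k * u k))) =
  (\sum_(k <oo) (odd_part u k)%:E <= \sum_(k <oo) (even_part u k)%:E)%E.
Proof.
move=> u0 cu.
have ce := is_cvg_even_part u0 cu; have co := is_cvg_odd_part u0 cu.
rewrite (eseries_EFin ce) (eseries_EFin co) lee_fin.
rewrite (_ : series (fun k => (-1) ^+ k * u k) = series (even_part u) - series (odd_part u)); last first.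
  apply/funext => n; rewrite /series/= fctE -sumrB; apply: eq_bigr => k _.
  rewrite -signr_odd /even_part /odd_part; case: (odd k).
    by rewrite expr1 mulN1r sub0r.
  by rewrite expr0 mul1r subr0.
by rewrite limB// subr_ge0.
Qed.

Lemma alternating_integral_ge0 (g : nat -> R -> R) (I : R^nat) :
  (forall k, measurable_fun Rpos (g k)) -> (forall k t, 0 <= g k t) ->
  (forall k, \int[mu]_(t in Rpos) (g k t)%:E = (I k)%:E)%E ->
  cvgn (series I) -> (forall t, 0 < t -> cvgn (series (g ^~ t))) ->
  (forall t, 0 < t -> 0 <= limn (series (fun k => (-1) ^+ k * g k t))) ->
  0 <= limn (series (fun k => (-1) ^+ k * I k)).
Proof.
move=> mg g0 gI cI cg Hg.
have I0 k : 0 <= I k.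
  by rewrite -lee_fin -gI; apply: integral_ge0 => t _; rewrite lee_fin.
rewrite alternating_lim_ge0//.
have me k : measurable_fun Rpos (fun t => (even_part (g ^~ t) k)%:E).
  apply/measurable_EFinP; rewrite /even_part.
  by case: (odd k); [exact: measurable_cst|exact: mg].
have mo k : measurable_fun Rpos (fun t => (odd_part (g ^~ t) k)%:E).
  apply/measurable_EFinP; rewrite /odd_part.
  by case: (odd k); [exact: mg|exact: measurable_cst].
have e0 k t : Rpos t -> (0 <= (even_part (g ^~ t) k)%:E)%E.
  by move=> _; rewrite lee_fin /even_part; case: ifP.
have o0 k t : Rpos t -> (0 <= (odd_part (g ^~ t) k)%:E)%E.
  by move=> _; rewrite lee_fin /odd_part; case: ifP.
have eI k : (\int[mu]_(t in Rpos) (even_part (g ^~ t) k)%:E = (even_part I k)%:E)%E.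
  rewrite /even_part; case: (odd k); last exact: gI.
  by rewrite integral0_eq.
have oI k : (\int[mu]_(t in Rpos) (odd_part (g ^~ t) k)%:E = (odd_part I k)%:E)%E.
  rewrite /odd_part; case: (odd k); first exact: gI.
  by rewrite integral0_eq.
under eq_eseriesr do rewrite -oI.
under [leRHS]eq_eseriesr do rewrite -eI.
rewrite -integral_nneseries//.
rewrite -integral_nneseries//.
apply: ge0_le_integral.
- exact: measurable_itv.
- by move=> t tp; apply: nneseries_ge0 => k _ _; exact: o0.
- by apply: ge0_emeasurable_sum; [move=> k t tp _; exact: o0|move=> k _; exact: mo].
- by apply: ge0_emeasurable_sum; [move=> k t tp _; exact: e0|move=> k _; exact: me].
- move=> t; rewrite /= in_itv/= andbT => t0.
  by rewrite -alternating_lim_ge0//; [exact: Hg|exact: cg].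
Qed.

End AlternatingIntegral.

(** * A bound on the first derivative of a completely monotone function *)

Section CMTaylor.
Variable R : realType.

Lemma is_derive_nincr (f df : R -> R) (b : R) : 0 < b ->
  (forall t : R, is_derive t 1 f (df t)) -> (forall t, 0 < t -> df t <= 0) -> f b <= f 0.
Proof.
move=> b0 dfE df0.
have cf : {within `[0, b], continuous f}.
  apply: derivable_within_continuous => t _; exact: ex_derive.
have [c] := MVT b0 (fun t _ => dfE t) cf.
rewrite in_itv/= => /andP[c0 _]; rewrite subr0 => e.
by rewrite -subr_le0 e mulr_le0_ge0 ?df0// ltW.
Qed.

Lemma is_derive_expr_fact (K : nat) (t : R) :
  is_derive t 1 (fun u : R => u ^+ K.+1 / K.+1`!%:R) (t ^+ K / K`!%:R).
Proof.
have h : is_derive t 1 (fun u : R => u ^+ K.+1) (K.+1%:R * t ^+ K).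
  apply: DeriveDef; first exact: exprn_derivable.
  by rewrite exp_derive /GRing.scale/= mulr1.
rewrite (_ : (fun u => _) = (fun u => (K.+1`!%:R)^-1 *: u ^+ K.+1)); last first.
  by apply/funext => u; rewrite /GRing.scale/= mulrC.
have h2 := @is_deriveZ _ _ _ (fun u : R => u ^+ K.+1) (K.+1`!%:R)^-1 t 1 _ h.
apply: is_derive_eq; rewrite factS natrM /GRing.scale/=.
have : K.+1%:R != 0 :> R by rewrite pnatr_eq0.
have : K`!%:R != 0 :> R by rewrite pnatr_eq0 -lt0n fact_gt0.
by move: (K.+1%:R : R) (K`!%:R : R) => u v u0 v0; field; rewrite u0 v0.
Qed.

Variable F : nat -> R -> R.
Hypothesis dF : forall k (t : R), is_derive t 1 (F k) (- F k.+1 t).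
Hypothesis F0 : forall k t, 0 < t -> 0 <= F k t.

(** The Taylor expansion of the j-th function from t back to 0, up to order K:
    the signs of F absorb those of (0-t)^k. *)
Definition taylor_back j K t := \sum_(k < K.+1) F (j + k) t * (t ^+ k / k`!%:R).

(** The derivative telescopes; what remains is the integrand of the remainder. *)
Lemma is_derive_taylor_back j K (t : R) :
  is_derive t 1 (taylor_back j K) (- (F (j + K.+1) t * (t ^+ K / K`!%:R))).
Proof.
rewrite /taylor_back; elim: K => [|K IH].
  rewrite (_ : (fun t => _) = F j); last first.
    by apply/funext => u; rewrite big_ord_recl big_ord0/= addn0 expr0 fact0 divr1 mulr1 addr0.
  by rewrite addn1 expr0 fact0 divr1 mulr1.
rewrite (_ : (fun t => _) = (fun t => \sum_(k < K.+1) F (j + k) t * (t ^+ k / k`!%:R))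
  + (fun t => F (j + K.+1) t * (t ^+ K.+1 / K.+1`!%:R))); last first.
  by apply/funext => u; rewrite big_ord_recr.
have dp : is_derive t 1 (fun u : R => u ^+ K.+1 / K.+1`!%:R) (t ^+ K / K`!%:R).
  exact: is_derive_expr_fact.
have d2 := is_deriveM (dF (j + K.+1) t) dp.
rewrite (_ : - _ = - (F (j + K.+1) t * (t ^+ K / K`!%:R)) +
  (F (j + K.+1) t *: (t ^+ K / K`!%:R) +
   (t ^+ K.+1 / K.+1`!%:R) *: (- F (j + K.+1).+1 t))).
  exact: is_deriveD.
by rewrite addnS /GRing.scale/=; ring.
Qed.

Lemma cm_le_at0 k t : 0 < t -> F k t <= F k 0.
Proof.
move=> t0; apply: (is_derive_nincr t0 (dF k)) => u u0.
by rewrite oppr_le0 F0.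
Qed.

Lemma taylor_back0 j K : taylor_back j K 0 = F j 0.
Proof.
rewrite /taylor_back big_ord_recl big1/= ?addn0 ?expr0 ?fact0 ?divr1 ?mulr1 ?addr0//.
by move=> i _; rewrite exprS !mul0r mulr0.
Qed.

(** Let a_k = F_k(N) N^k / k!, which is nonnegative. The expansion of F_0(0) at N
    has nonnegative remainder, so that the a_k add up to at most F_0(0). In the
    expansion of F_1(0) the terms of order below K, multiplied by N, are the
    k a_k with k <= K, hence at most K F_0(0), and F_(K+1) <= F_(K+1)(0) bounds
    the remainder. *)
Lemma cm_first_derivative_bound (N : R) K : 0 < N ->
  N * F 1 0 <= K%:R * F 0 0 + F K.+1 0 * (N ^+ K.+1 / K`!%:R).
Proof.
move=> N0; case: K => [|K].
  by rewrite mul0r add0r expr1 fact0 divr1 mulrC.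
have hA : taylor_back 0 K.+1 N <= F 0 0.
  rewrite -(taylor_back0 0 K.+1).
  apply: (is_derive_nincr N0 (is_derive_taylor_back 0 K.+1)) => t t0.
  by rewrite oppr_le0 mulr_ge0 ?F0// divr_ge0 ?exprn_ge0 ?(ltW t0)// ler0n.
have hB : F 1 0 <= taylor_back 1 K N + F K.+2 0 * (N ^+ K.+1 / K.+1`!%:R).
  have dG (t : R) : is_derive t 1
      (fun u => - taylor_back 1 K u - F K.+2 0 * (u ^+ K.+1 / K.+1`!%:R))
      (F K.+2 t * (t ^+ K / K`!%:R) - F K.+2 0 * (t ^+ K / K`!%:R)).
    have d1 := is_derive_taylor_back 1 K t.
    have d2 := @is_deriveZ _ _ _ _ (F K.+2 0) t 1 _ (is_derive_expr_fact K t).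
    rewrite -[F K.+2 t * _]opprK.
    exact: (is_deriveB (is_deriveN d1) d2).
  have := is_derive_nincr N0 dG.
  rewrite taylor_back0 expr0n/= mul0r mulr0 subr0.
  have H t : 0 < t -> F K.+2 t * (t ^+ K / K`!%:R) - F K.+2 0 * (t ^+ K / K`!%:R) <= 0.
    move=> t0; rewrite subr_le0 ler_wpM2r ?cm_le_at0//.
    by rewrite divr_ge0 ?exprn_ge0 ?(ltW t0)// ler0n.
  move=> /(_ H); lra.
have hAB : N * taylor_back 1 K N <= K.+1%:R * taylor_back 0 K.+1 N.
  rewrite /taylor_back [X in _ <= _ * X]big_ord_recl mulrDr !mulr_sumr.
  rewrite -[leLHS]add0r; apply: lerD.
    by rewrite mulr_ge0// mulr_ge0 ?F0// divr_ge0 ?exprn_ge0 ?(ltW N0)// ler0n.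
  apply: ler_sum => i _; rewrite /bump/= add1n add0n.
  have -> : N * (F i.+1 N * (N ^+ i / i`!%:R)) =
      i.+1%:R * (F i.+1 N * (N ^+ i.+1 / i.+1`!%:R)).
    rewrite factS natrM exprS.
    have : i.+1%:R != 0 :> R by rewrite pnatr_eq0.
    have : i`!%:R != 0 :> R by rewrite pnatr_eq0 -lt0n fact_gt0.
    by move: (i.+1%:R : R) (i`!%:R : R) => u v u0 v0; field; rewrite u0 v0.
  rewrite ler_wpM2r//; last by rewrite ler_nat.
  by rewrite mulr_ge0 ?F0// divr_ge0 ?exprn_ge0 ?(ltW N0)// ler0n.
have K0 : 0 <= K.+1%:R :> R by [].
apply: (le_trans (ler_wpM2l (ltW N0) hB)).
rewrite mulrDr lerD//; first exact: le_trans hAB (ler_wpM2l K0 hA).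
by rewrite [N ^+ K.+2]exprS le_eqVlt; apply/orP; left; apply/eqP; ring.
Qed.

End CMTaylor.

(** * The characterization *)

Section Main.
Variables (R : realType) (al be ga : R).
Hypotheses (a0 : 0 < al) (b0 : 0 < be) (g0 : 0 < ga).
Local Notation mu := (@lebesgue_measure R).
Local Notation Rpos := (`]0, +oo[%classic : set R).

Let bk0 k : 0 < be + al * k%:R.
Proof. by rewrite ltr_wpDr// mulr_ge0// ltW. Qed.
Let gk0 k : 0 < ga + k%:R.
Proof. by rewrite ltr_wpDr. Qed.

(** The function (-1)^k (d/dt)^k E(-t). *)
Definition signed_derivative k (t : R) : R :=
  k`!%:R * negbin ga k * prabhakar al (be + al * k%:R) (ga + k%:R) (- t).

Lemma is_derive_signed_derivative k (t : R) :
  is_derive t 1 (signed_derivative k) (- signed_derivative k.+1 t).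
Proof.
have d1 := is_derive_prabhakar (- t) a0 (bk0 k) (gk0 k).
have d2 : is_derive t 1 (fun u : R => - u) (-1) by apply: is_derive_eq.
have d3 := is_derive1_comp d1 d2.
have d4 := @is_deriveZ _ _ _ _ (k`!%:R * negbin ga k) t 1 _ d3.
have -> : - signed_derivative k.+1 t = (k`!%:R * negbin ga k) *:
    ((ga + k%:R) * prabhakar al (be + al * k%:R + al) (ga + k%:R + 1) (- t) * -1).
  rewrite /signed_derivative negbinS factS natrM.
  have -> : be + al * k.+1%:R = be + al * k%:R + al by rewrite -(natr1 k); ring.
  have -> : ga + k.+1%:R = ga + k%:R + 1 by rewrite -(natr1 k) addrA.
  have : k.+1%:R != 0 :> R by rewrite pnatr_eq0.
  by rewrite /GRing.scale/=; move: (k.+1%:R : R) => u u0; field.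
exact: d4.
Qed.

Lemma derive1n_prabhakar k :
  derive1n k (fun x => prabhakar al be ga (- x)) = (fun x => (-1) ^+ k * signed_derivative k x).
Proof.
elim: k => [|k IH].
  by apply/funext => x; rewrite derive1n0 /signed_derivative negbin0 fact0 mulr0 !addr0 expr0 !mul1r.
rewrite derive1nS IH; apply/funext => x; rewrite derive1E.
have d := @is_deriveZ _ _ _ _ ((-1) ^+ k) x 1 _ (is_derive_signed_derivative k x).
by rewrite (@derive_val _ _ _ _ _ _ _ d) /GRing.scale/= exprS; ring.
Qed.

Lemma completely_monotone_prabhakarE :
  completely_monotone (fun x => prabhakar al be ga (- x)) <->
  (forall k x, 0 < x -> 0 <= signed_derivative k x).
Proof.
split=> [[_ H] k x x0|H].
  have := H k x x0; rewrite derive1n_prabhakar mulrA -exprMn mulrNN mulr1 expr1n mul1r//.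
split=> [n x x0|n x x0].
  rewrite derive1n_prabhakar.
  have d := @is_deriveZ _ _ _ _ ((-1) ^+ n) x 1 _ (is_derive_signed_derivative n x).
  exact: (@ex_derive _ _ _ _ _ _ _ d).
by rewrite derive1n_prabhakar mulrA -exprMn mulrNN mulr1 expr1n mul1r H.
Qed.

Lemma signed_derivative0 k : signed_derivative k 0 = k`!%:R * prabhakar_coeff al be ga k.
Proof.
have E : prabhakar al (be + al * k%:R) (ga + k%:R) 0 = (Gamma (be + al * k%:R))^-1.
  have h1 : pseries (prabhakar_coeff al (be + al * k%:R) (ga + k%:R)) 0 @ \oo -->
      prabhakar al (be + al * k%:R) (ga + k%:R) 0 by exact: prabhakar_is_cvg.
  have h2 : (fun _ : nat => (Gamma (be + al * k%:R))^-1) @ \oo -->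
      (Gamma (be + al * k%:R))^-1 by exact: cvg_cst.
  apply: (cvgn_eq (cvgn_shift h1) h2) => N.
  rewrite /pseries /series/= big_nat_recl// big1 ?addr0.
    by rewrite prabhakar_coeffE// negbin0 mulr0 addr0 expr0 mulr1 mul1r.
  by move=> i _; rewrite exprS mul0r mulr0.
by rewrite /signed_derivative oppr0 E prabhakar_coeffE// mulrA.
Qed.

(** If al > 1, [cm_first_derivative_bound] at N = A n and K = n-1 bounds A F_1(0)
    by F_0(0) + c_n (A n)^n, where c_n (A n)^n <= C for n large: by the bound on
    c_n with x = n it is at most C (n+1) (const n^(1-al))^n. *)
Lemma completely_monotone_alpha_le1 :
  (forall k x, 0 < x -> 0 <= signed_derivative k x) -> al <= 1.
Proof.
move=> H; rewrite leNgt; apply/negP => a1.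
pose F0 := signed_derivative 0 0; pose F1 := signed_derivative 1 0.
have F00 : 0 < F0 by rewrite /F0 signed_derivative0 mulr_gt0 ?ltr0n ?fact_gt0// prabhakar_coeff_gt0.
have F10 : 0 < F1 by rewrite /F1 signed_derivative0 mulr_gt0 ?ltr0n ?fact_gt0// prabhakar_coeff_gt0.
pose C := (be + al) * expR 1.
have C0 : 0 < C by rewrite mulr_gt0 ?addr_gt0 ?expR_gt0.
(* chosen so that A * F1 exceeds the bound F0 + C *)
pose A := (F0 + C + 1) / F1.
have A0 : 0 < A by rewrite divr_gt0//; lra.
(* n^(al-1) >= W makes the base of the n-th power at most 1/2 *)
pose W := 2 * ((1 + ga) * A * expR 1).
have W0 : 0 < W.
  rewrite /W; apply: mulr_gt0 => //; apply: mulr_gt0; last exact: expR_gt0.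
  by apply: mulr_gt0 => //; rewrite addr_gt0.
have a10 : 0 < al - 1 by rewrite subr_gt0.
have [m nW] : exists m : nat, W <= m.+1%:R `^ (al - 1).
  exists (Num.truncn (W `^ (al - 1)^-1)).
  have {1}-> : W = (W `^ (al - 1)^-1) `^ (al - 1).
    by rewrite -powRrM mulVf ?gt_eqF// powRr1// ltW.
  apply: ge0_ler_powR; rewrite ?nnegrE ?powR_ge0 ?(ltW a10)//.
  by rewrite ltW// truncnS_gt.
have [n nm] : exists n, n = m.+1 by exists m.+1.
rewrite -nm in nW.
have n1 : 1 <= n%:R :> R by rewrite nm ler1n.
have n0 : 0 < n%:R :> R by exact: lt_le_trans n1.
have key := cm_first_derivative_bound is_derive_signed_derivative H m (mulr_gt0 A0 n0).
rewrite -/F0 -/F1 -nm signed_derivative0 in key.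
clearbody F0 F1.
set c := prabhakar_coeff al be ga n in key.
have c0 : 0 < c by exact: prabhakar_coeff_gt0.
have small : c * (A * n%:R) ^+ n <= C.
  have h := prabhakar_coeff_le n a0 b0 g0 n0; rewrite -/c in h.
  have An0 : 0 <= (A * n%:R) ^+ n by rewrite exprn_ge0// mulr_ge0// ltW.
  apply: (le_trans (ler_wpM2r An0 h)).
  have e1 : expR (n%:R + 1) = expR 1 * expR 1 ^+ n :> R.
    by rewrite expRD mulrC -expRM_natr mul1r.
  have -> : (be + al) * n.+1%:R * (1 + ga) ^+ n *
     (n%:R `^ (- be) * expR (n%:R + 1) * n%:R `^ (- al) ^+ n) * (A * n%:R) ^+ n =
     C * (n%:R `^ (- be) * (n.+1%:R *
       ((1 + ga) * A * expR 1 * (n%:R `^ (- al) * n%:R)) ^+ n)).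
    by rewrite e1 /C !exprMn; ring.
  rewrite ler_piMr ?(ltW C0)//.
  have nb : n%:R `^ (- be) <= 1 :> R.
    rewrite powRN invf_le1 ?powR_gt0//.
    by apply: (le_trans _ (ler_powR n1 (ltW b0))); rewrite powRr0.
  have B0 : 0 <= (1 + ga) * A * expR 1 * (n%:R `^ (- al) * n%:R).
    apply: mulr_ge0; last by rewrite mulr_ge0 ?powR_ge0.
    apply: mulr_ge0; last exact: expR_ge0.
    by apply: mulr_ge0; [rewrite addr_ge0// ltW|exact: ltW].
  have B1 : (1 + ga) * A * expR 1 * (n%:R `^ (- al) * n%:R) <= 2^-1.
    have -> : n%:R `^ (- al) * n%:R = (n%:R `^ (al - 1))^-1 :> R.
      rewrite -powRN -[X in _ * X](powRr1 (ltW n0)) -powRD ?(gt_eqF n0) ?implybT//.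
      by congr (_ `^ _); ring.
    rewrite ler_pdivrMr ?powR_gt0// -[leLHS](mulKf (_ : 2 != 0 :> R)) ?pnatr_eq0//.
    by rewrite ler_pM2l ?invr_gt0.
  rewrite mulr_ile1 ?powR_ge0 ?mulr_ge0 ?exprn_ge0//.
  apply: (@le_trans _ _ (n.+1%:R * 2^-1 ^+ n)).
    by rewrite ler_wpM2l// lerXn2r ?nnegrE// invr_ge0.
  rewrite exprVn ler_pdivrMr ?exprn_gt0// mul1r -natrX ler_nat.
  exact: ltn_expl.
have key2 : A * F1 <= F0 + c * (A * n%:R) ^+ n.
  rewrite -(ler_pM2l n0).
  have : m%:R * F0 <= n%:R * F0.
    by rewrite ler_wpM2r ?(ltW F00)// ler_nat nm.
  have e : n`!%:R * c * ((A * n%:R) ^+ n / m`!%:R) = n%:R * (c * (A * n%:R) ^+ n).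
    have : m`!%:R != 0 :> R by rewrite pnatr_eq0 -lt0n fact_gt0.
    rewrite {1}nm factS natrM -nm; move: (m`!%:R : R) => u u0.
    by move: (_ ^+ n) => v; field.
  rewrite e in key; move=> h.
  rewrite mulrDr; apply: le_trans (lerD h (lexx _)).
  by rewrite mulrA [n%:R * A]mulrC.
have e : A * F1 = F0 + C + 1 by rewrite /A divfK// gt_eqF.
by rewrite e in key2; lra.
Qed.

(** The coefficient, multiplied by n!, is the integral over u > 0 of
    u^(be+n-1) e^(-u) E(-l u^al), evaluated term by term. *)
Lemma rcoef_ge0_of_prabhakar l n : 0 < l -> l < 1 ->
  (forall x, 0 < x -> 0 <= prabhakar al be ga (- x)) -> 0 <= rcoef al l ga be n.
Proof.
move=> l0 l1 H.
have nf0 : 0 < n`!%:R :> R by rewrite ltr0n fact_gt0.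
have c0 k : 0 < prabhakar_coeff al be ga k by exact: prabhakar_coeff_gt0.
have bn0 k : 0 < be + al * k%:R + n%:R by rewrite ltr_wpDr.
pose I k := prabhakar_coeff al be ga k * l ^+ k * Gamma (be + al * k%:R + n%:R).
pose g k t := prabhakar_coeff al be ga k * l ^+ k * gamma_kernel (be + al * k%:R + n%:R) t.
have cl0 k : 0 <= prabhakar_coeff al be ga k * l ^+ k.
  by rewrite mulr_ge0 ?exprn_ge0// ltW.
have IE k : (-1) ^+ k * I k = n`!%:R * rterm al l ga be n k.
  rewrite /I /rterm prabhakar_coeffE// (GammaDn _ (bk0 k)) -[- l]mulN1r exprMn.
  have : Gamma (be + al * k%:R) != 0 by rewrite gt_eqF// Gamma_gt0.
  by move: (Gamma _) (negbin _ n) => u v u0; field.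
have I0 k : 0 <= I k by rewrite mulr_ge0// ltW// Gamma_gt0.
have Inorm k : I k = n`!%:R * `|rterm al l ga be n k|.
  rewrite -[in RHS](ger0_norm (ltW nf0)) -normrM -IE normrM normrX normrN1 expr1n mul1r.
  by rewrite ger0_norm.
have cI : cvgn (series I).
  rewrite (_ : series I = fun N => n`!%:R * series (fun k => `|rterm al l ga be n k|) N).
    by apply: is_cvgMr; apply: is_cvg_norm_rterm => //; exact: ltW.
  by apply/funext => N; rewrite /series/= mulr_sumr; apply: eq_bigr => k _.
have gE t k : 0 < t -> g k t = t `^ (be + n%:R - 1) * expR (- t) *
    (prabhakar_coeff al be ga k * (l * t `^ al) ^+ k).
  move=> t0; rewrite /g /gamma_kernel exprMn -[(t `^ al) ^+ k]powR_mulrn ?powR_ge0//.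
  rewrite -powRrM.
  have -> : be + al * k%:R + n%:R - 1 = be + n%:R - 1 + al * k%:R by ring.
  by rewrite powRD ?(gt_eqF t0) ?implybT//; ring.
suff h : 0 <= limn (series (fun k => (-1) ^+ k * I k)).
  rewrite -(pmulr_rge0 _ nf0); apply: le_trans h _.
  rewrite le_eqVlt; apply/orP; left; apply/eqP/cvg_lim => //.
  rewrite (_ : series _ = fun N => n`!%:R * series (rterm al l ga be n) N).
    by apply: cvgn_scale; apply: rcoef_cvg => //; exact: ltW.
  by apply/funext => N; rewrite /series/= mulr_sumr; apply: eq_bigr => k _; exact: IE.
apply: (@alternating_integral_ge0 _ g).
- move=> k; apply: measurable_funM; first exact: measurable_cst.
  exact: measurable_gamma_kernel.
- by move=> k t; rewrite mulr_ge0// gamma_kernel_ge0.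
- move=> k; rewrite /g /I; under eq_integral do rewrite EFinM.
  rewrite ge0_integralZl_EFin; [|exact: measurable_itv
    |by move=> t _; rewrite lee_fin gamma_kernel_ge0
    |by apply/measurable_EFinP; exact: measurable_gamma_kernel|exact: cl0].
  by rewrite -/(eGamma _) -EFin_Gamma.
- exact: cI.
- move=> t t0.
  rewrite (_ : series _ = fun N => t `^ (be + n%:R - 1) * expR (- t) *
    pseries (prabhakar_coeff al be ga) (l * t `^ al) N).
    by apply: is_cvgMr; exact: prabhakar_is_cvg.
  by apply/funext => N; rewrite /pseries /series/= mulr_sumr; apply: eq_bigr => k _; rewrite gE.
- move=> t t0.
  rewrite (_ : series _ = fun N => t `^ (be + n%:R - 1) * expR (- t) *
    pseries (prabhakar_coeff al be ga) (- (l * t `^ al)) N); last first.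
    apply/funext => N; rewrite /pseries /series/= mulr_sumr; apply: eq_bigr => k _.
    by rewrite gE// -[- (l * _)]mulN1r [(-1 * _) ^+ k]exprMn; ring.
  have -> : limn (fun N => t `^ (be + n%:R - 1) * expR (- t) *
    pseries (prabhakar_coeff al be ga) (- (l * t `^ al)) N) =
    t `^ (be + n%:R - 1) * expR (- t) * prabhakar al be ga (- (l * t `^ al)).
    by apply/cvg_lim => //; apply: cvgn_scale; exact: prabhakar_is_cvg.
  rewrite mulr_ge0 ?mulr_ge0 ?powR_ge0 ?expR_ge0//.
  by apply: H; rewrite mulr_gt0// powR_gt0.
Qed.

End Main.

Theorem corollary1 (R : realType) (alpha beta gamma : R)
    (alpha_gt0 : 0 < alpha) (beta_gt0 : 0 < beta) (gamma_gt0 : 0 < gamma) :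
  completely_monotone (fun x : R => prabhakar alpha beta gamma (- x)) <->
  (0 < alpha <= 1) /\ alpha * gamma <= beta.
Proof.
rewrite (completely_monotone_prabhakarE alpha_gt0 beta_gt0 gamma_gt0); split=> [H|[a01 abg] k x x0].
  have a1 : alpha <= 1 by exact: completely_monotone_alpha_le1 H.
  split; first by rewrite alpha_gt0.
  rewrite leNgt; apply/negP => ba.
  have l0 : 0 < 2^-1 :> R by rewrite invr_gt0.
  have l1 : 2^-1 < 1 :> R by lra.
  apply: (rcoef_not_ge0 alpha_gt0 l0 l1 a1 gamma_gt0 ba) => n.
  apply: rcoef_ge0_of_prabhakar => // x x0.
  have := H 0%N x x0.
  by rewrite /signed_derivative fact0 negbin0 mulr0 !addr0 !mul1r.
rewrite /signed_derivative mulr_ge0//.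
  by rewrite mulr_ge0 ?ler0n// negbin_ge0// ltW.
apply: prabhakar_ge0 => //.
- by rewrite ltr_wpDr// mulr_ge0// ltW.
- by rewrite ltr_wpDr.
- by rewrite mulrDr lerD2r.
Qed.
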